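(* Let $V$ be a vertex operator algebra. The functor $\mathcal{PI}_{12}:V\text{-mod}\times(V\text{-mod}^{op})^2\to\mathrm{Vect}_{\mathbb C}$, $(M_0,M_1,M_2)\mapsto\mathcal{PI}_{12}\binom{M_0}{M_1M_2}$, of parenthesized intertwining operators for the tree $12$ is naturally isomorphic, as a $\mathbb C$-linear functor, to the functor of logarithmic intertwining operators $(M_0,M_1,M_2)\mapsto I_{\log}\binom{M_0}{M_1M_2}$.
   Context: All vector spaces are over $\mathbb C$. A vertex operator algebra $V$ is of CFT type: $V=\bigoplus_{n\ge0}V_n$ ($L(0)$-grading), $\dim V_n<\infty$, $V_0=\mathbb C\mathbf 1$; $Y(a,z)=\sum_na(n)z^{-n-1}$, $L(n)=\omega(n+1)$. $V\text{-mod}$ is the category of $V$-modules $M$ satisfying: (M1) $L(0)$ is locally finite; (M2) the generalized eigenspaces $M_h$ of $L(0)$ are finite-dimensional; (M3) there is $N$ with $(L(0)-h)^N|_{M_h}=0$ for all $h$; (M4) $M=\bigoplus_{i=1}^n\bigoplus_{k\ge0}M_{\Delta_i+k}$ for finitely many $\Delta_i\in\mathbb C$. $M^\vee=\bigoplus_hM_h^*$ is the restricted dual. **Logarithmic intertwining operators.** $I_{\log}\binom{M_0}{M_1M_2}$ is the space of linear maps $\mathcal Y(\cdot,z):M_1\to\mathrm{Hom}(M_2,M_0)[[z^{\mathbb C}]][\log z]$ ($\log z$ a formal variable with $\frac d{dz}\log z=z^{-1}$) such that (I1) $\mathcal Y(m_1,z)m_2\in M_0[[z]][z^{\mathbb C},\log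 z]$; (I2) $[L(-1),\mathcal Y(m,z)]=\frac d{dz}\mathcal Y(m,z)$; (I3) for $a\in V$, $n\in\mathbb Z$: $[a(n),\mathcal Y(m,z)]=\sum_{k\ge0}\binom nk\mathcal Y(a(k)m,z)z^{n-k}$ and $\mathcal Y(a(n)m,z)=\sum_{k\ge0}\binom nk\big(a(n-k)\mathcal Y(m,z)(-z)^k-\mathcal Y(m,z)a(k)(-z)^{n-k}\big)$. **Parenthesized intertwining operators for the tree $12$.** Here $12$ is the binary tree with left leaf $1$ and right leaf $2$. It has one non-leaf vertex, with variable $x=x_{12}=z_1-z_2$, and $T_{12}^{conv}=T_{12}=\mathbb C[x^{\mathbb C},\log x]$ (finite linear combinations of $x^s(\log x)^k$, $s\in\mathbb C$, $k\in\mathbb Z_{\ge0}$), with $\frac d{dz_1}=\frac d{dx}$. $\mathcal{PI}_{12}\binom{M_0}{M_1M_2}$ is the space of linear maps $F:M_1\otimes M_2\to M_0[[x^{\mathbb C},\log x]]$ such that (PI0) $\langle u,F(m_1,m_2)\rangle\in T_{12}^{conv}$ for all $u\in M_0^\vee$; (PI1) $F(L(-1)m_1,m_2)=\frac d{dx}F(m_1,m_2)$; (PI2) for all $a\in V$, $n\in\mathbb Z$: $F(a(n)m_1,m_2)=\sum_{k\ge0}\binom nk(-x)^ka(n-k)F(m_1,m_2)-\sum_{k\ge0}\binom nk(-x)^{n-k}F(m_1,a(k)m_2)$ and $F(m_1,a(n)m_2)=a(n)F(m_1,m_2)-\sum_{k\ge0}\binom nkx^{n-k}F(a(k)m_1,m_2)$.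 *)

(* Defs.v *)
From HB Require Import structures.
From mathcomp Require Import all_boot all_order all_algebra.
From mathcomp Require Import all_classical all_reals.
From mathcomp Require Import complex.

Set Implicit Arguments.
Unset Strict Implicit.
Unset Printing Implicit Defensive.

Import GRing.Theory.
Local Open Scope classical_set_scope.
Local Open Scope ring_scope.

(* A linear subspace of [W], given by a [Prop]-valued predicate; [subspace_type]
   turns it into a vector space in its own right. *)
Record subspace (K : fieldType) (W : lmodType K) := Subspace {
  subspace_set :> set W;
  subspace0 : subspace_set 0;
  subspaceP : forall (c : K) (u v : W),
    subspace_set u -> subspace_set v -> subspace_set (c *: u + v) }.

Definition subspace_pred (K : fieldType) (W : lmodType K) (S : subspace W) :
  {pred W} := fun x => `[< subspace_set S x >].

Lemma subspace_pred_closed (K : fieldType) (W : lmodType K) (S : subspace W) :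
  submod_closed (subspace_pred S).
Proof.
split=> [|c u v /asboolP Su /asboolP Sv]; apply/asboolP.
  exact: subspace0.
exact: subspaceP.
Qed.

HB.instance Definition _ (K : fieldType) (W : lmodType K) (S : subspace W) :=
  GRing.isSubmodClosed.Build K W (subspace_pred S) (subspace_pred_closed S).

Record subspace_type (K : fieldType) (W : lmodType K) (S : subspace W) :=
  SubspaceElt { elt : W; eltP : elt \in subspace_pred S }.

HB.instance Definition _ (K : fieldType) (W : lmodType K) (S : subspace W) :=
  [isSub for @elt K W S].
HB.instance Definition _ (K : fieldType) (W : lmodType K) (S : subspace W) :=
  [Choice of subspace_type S by <:].
HB.instance Definition _ (K : fieldType) (W : lmodType K) (S : subspace W) :=
  [SubChoice_isSubLmodule of subspace_type S by <:].

Definition mk_elt (K : fieldType) (W : lmodType K) (S : subspace W) (w : W)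
  (Sw : subspace_set S w) : subspace_type S := SubspaceElt (asboolT Sw).

Lemma elt_in (K : fieldType) (W : lmodType K) (S : subspace W)
  (x : subspace_type S) : subspace_set S (elt x).
Proof. exact/asboolP/eltP. Qed.

Lemma elt_mk (K : fieldType) (W : lmodType K) (S : subspace W) (w : W)
  (Sw : subspace_set S w) : elt (mk_elt Sw) = w.
Proof. by []. Qed.

Lemma elt_linear (K : fieldType) (W : lmodType K) (S : subspace W) (c : K)
  (x y : subspace_type S) : elt (c *: x + y) = c *: elt x + elt y.
Proof. by []. Qed.

Lemma elt_inj (K : fieldType) (W : lmodType K) (S : subspace W) :
  injective (@elt K W S).
Proof. exact: val_inj. Qed.

Section LinearAlgebra.
Context {K : fieldType} {U : lmodType K}.

(* [\sum_(k >= 0) f k = s], where only finitely many terms are nonzero. *)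
Definition sum_is (f : nat -> U) (s : U) : Prop :=
  exists N, forall n, (N <= n)%N -> \sum_(k < n) f k = s.

Definition spanned_by (e : seq U) : set U :=
  [set u | exists c : nat -> K, u = \sum_(i < size e) c i *: e`_i].

Definition finite_dimensional (P : set U) : Prop :=
  exists e : seq U, P `<=` spanned_by e.

Definition locally_finite (T : U -> U) : Prop :=
  forall u, exists e : seq U,
    spanned_by e u /\ (forall v, spanned_by e v -> spanned_by e (T v)).

Definition nilpotent_at (T : U -> U) (h : K) (N : nat) (u : U) : Prop :=
  iter N (fun v => T v - h *: v) u = 0.

Definition gen_eigenspace (T : U -> U) (h : K) : set U :=
  [set u | exists N, nilpotent_at T h N u].

Definition is_direct_sum (I : choiceType) (P : I -> set U) : Prop :=
  forall u, exists! f : I -> U,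
    [/\ finite_set [set i | f i != 0], forall i, P i (f i)
      & u = \sum_(i \in [set: I]) f i].

End LinearAlgebra.

Lemma sum_is_lin (K : fieldType) (U W : lmodType K) (g : U -> W) f s :
  linear g -> sum_is f s -> sum_is (fun k => g (f k)) (g s).
Proof.
move=> lg [N fN]; exists N => n /fN <-.
pose gl := GRing.isLinear.Build _ _ _ _ g lg.
pose G : {linear U -> W} := HB.pack g gl.
by rewrite -[g (\sum_(k < n) f k)]/(G _) linear_sum.
Qed.

Lemma sum_is_comb (K : fieldType) (U : lmodType K) (c : K) (f g : nat -> U) s t :
  sum_is f s -> sum_is g t ->
  sum_is (fun k => c *: f k + g k) (c *: s + t).
Proof.
move=> [N fN] [M gM]; exists (maxn N M) => n.
rewrite geq_max => /andP[/fN <- /gM <-].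
by rewrite big_split scaler_sumr.
Qed.

Lemma fct_combE (K : fieldType) (T : Type) (U : lmodType K) (c : K)
  (f g : T -> U) x : (c *: f + g) x = c *: f x + g x.
Proof. by []. Qed.

Section Vertex.
Context {R : realType}.
Local Notation C := R[i].

(* [binom(n, k)] for an integer [n], possibly negative. *)
Definition binz (n : int) (k : nat) : C :=
  (\prod_(i < k) (n - i%:Z)%:~R) / (k`!)%:R.

Definition sgn (n : int) : C := (-1) ^ n.

(* [vop a n b] is [a(n) b] and [act a n m] is [a(n) m]. *)
Section WeakModules.
Context {A M : lmodType C}.
Variables (vop : A -> int -> A -> A) (vac : A) (act : A -> int -> M -> M).

Definition borcherds : Prop :=
  forall (a b : A) (p q r : int) (m : M), exists S : M,
    sum_is (fun i : nat => binz p i *: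
              act (vop a (r + i%:Z) b) (p + q - i%:Z) m) S /\
    sum_is (fun i : nat => (sgn i%:Z * binz r i) *:
              (act a (p + r - i%:Z) (act b (q + i%:Z) m)
               - sgn r *: act b (q + r - i%:Z) (act a (p + i%:Z) m))) S.

Record weak_module : Prop := WeakModuleLaws {
  act_linearl : forall n m, linear (fun a => act a n m);
  act_linearr : forall a n, linear (act a n);
  act_truncation : forall a m, exists N : nat,
    forall n : nat, (N <= n)%N -> act a n%:Z m = 0;
  act_vacuum : forall n m, act vac n m = if n == -1 then m else 0;
  act_borcherds : borcherds }.

End WeakModules.

Record voa := VOA {
  voa_sort :> lmodType C;
  vop : voa_sort -> int -> voa_sort -> voa_sort;
  vac : voa_sort;
  omega : voa_sort;
  central_charge : C;
  voa_module : weak_module vop vac vop;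
  voa_creation : forall a, vop a (-1) vac = a;
  voa_creation0 : forall a (n : nat), vop a n%:Z vac = 0;
  voa_virasoro : forall (m n : int) (a : voa_sort),
    vop omega (m + 1) (vop omega (n + 1) a)
    - vop omega (n + 1) (vop omega (m + 1) a) =
    (m - n)%:~R *: vop omega (m + n + 1) a
    + (if m + n == 0 then (m ^+ 3 - m)%:~R / 12%:R * central_charge else 0) *: a;
  voa_derivative : forall (a b : voa_sort) (n : int),
    vop (vop omega 0 a) n b = (- n)%:~R *: vop a (n - 1) b;
  voa_grading : is_direct_sum
    (fun n : nat => [set a | vop omega 1 a = n%:R *: a]);
  voa_finite : forall n : nat,
    finite_dimensional [set a | vop omega 1 a = n%:R *: a];
  voa_CFT : [set a | vop omega 1 a = 0] = [set c *: vac | c in [set: C]] }.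

Section Modules.
Context (V : voa).

Definition Lop (M : lmodType C) (act : V -> int -> M -> M) (n : int) : M -> M :=
  act (omega V) (n + 1).

Record vmod := VMod {
  vmod_sort :> lmodType C;
  act : V -> int -> vmod_sort -> vmod_sort;
  vmod_laws : weak_module (@vop V) (vac V) act;
  vmod_locally_finite : locally_finite (Lop act 0);
  vmod_finite : forall h, finite_dimensional (gen_eigenspace (Lop act 0) h);
  vmod_nilpotent : exists N, forall h m,
    gen_eigenspace (Lop act 0) h m -> nilpotent_at (Lop act 0) h N m;
  vmod_grading : exists (n : nat) (Delta : 'I_n -> C),
    is_direct_sum (fun ik : 'I_n * nat =>
      gen_eigenspace (Lop act 0) (Delta ik.1 + ik.2%:R)) }.

Definition Lmode (M : vmod) (n : int) : M -> M := Lop (@act M) n.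

Definition weight_space (M : vmod) (h : C) : set M := gen_eigenspace (Lmode 0) h.

(* Elements of the restricted dual: as [M] is the direct sum of its weight
   spaces, the direct sum of their duals is the space of the linear forms that
   vanish on all but finitely many of them. *)
Definition restricted_dual (M : vmod) : set (M -> C) :=
  [set u | scalar u /\
     finite_set [set h | exists2 m, weight_space h m & u m != 0]].

Definition is_vhom (M N : vmod) (f : M -> N) : Prop :=
  linear f /\ forall a n m, f (act a n m) = act a n (f m).

Lemma is_vhom0 (M N : vmod) : is_vhom (0 : M -> N).
Proof.
split=> [c x y|a n m] /=; first by rewrite /= scaler0 addr0.
have := @act_linearr _ _ _ _ _ (vmod_laws N) a n (-1) 0 0.
by rewrite !scaler0 !addr0 scaleN1r addNr.
Qed.

Lemma is_vhomD (M N : vmod) (c : C) (f g : M -> N) :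
  is_vhom f -> is_vhom g -> is_vhom (c *: f + g).
Proof.
move=> [lf af] [lg ag]; split=> [d x y|a n m]; rewrite !fct_combE.
  by rewrite lf lg !scalerDr !scalerA [d * c]mulrC addrACA.
by rewrite af ag (act_linearr (vmod_laws N)).
Qed.

Definition vhom_space (M N : vmod) : subspace (M -> N : lmodType C) :=
  Subspace (@is_vhom0 M N) (@is_vhomD M N).

Definition vhom (M N : vmod) : lmodType C := subspace_type (vhom_space M N).

Definition vhom_fun (M N : vmod) (f : vhom M N) : M -> N := elt f.

Lemma vhomP (M N : vmod) (f : vhom M N) : is_vhom (vhom_fun f).
Proof. exact: (elt_in (S := vhom_space M N) f). Qed.

Lemma is_vhom_id (M : vmod) : is_vhom (@idfun M).
Proof. by []. Qed.

Definition vid (M : vmod) : vhom M M :=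
  mk_elt (S := vhom_space M M) (is_vhom_id M).

Lemma is_vhom_comp (M N P : vmod) (g : vhom N P) (f : vhom M N) :
  is_vhom (vhom_fun g \o vhom_fun f).
Proof.
have [lg ag] := vhomP g; have [lf af] := vhomP f.
by split=> [c x y|a n m] /=; rewrite ?lf ?lg ?af ?ag.
Qed.

Definition vcomp (M N P : vmod) (g : vhom N P) (f : vhom M N) : vhom M P :=
  mk_elt (S := vhom_space M P) (is_vhom_comp g f).

(* C-linear functors [V-mod * (V-mod^op)^2 -> Vect], C-linear meaning linear in
   each of the three morphisms. *)
Record trifunctor := Trifunctor {
  tf_obj : vmod -> vmod -> vmod -> lmodType C;
  tf_map : forall M0 M1 M2 N0 N1 N2 : vmod,
    vhom M0 N0 -> vhom N1 M1 -> vhom N2 M2 ->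
    {linear tf_obj M0 M1 M2 -> tf_obj N0 N1 N2};
  tf_id : forall M0 M1 M2 x, tf_map (vid M0) (vid M1) (vid M2) x = x;
  tf_comp : forall M0 M1 M2 N0 N1 N2 P0 P1 P2
    (f : vhom M0 N0) (g1 : vhom N1 M1) (g2 : vhom N2 M2)
    (f' : vhom N0 P0) (g1' : vhom P1 N1) (g2' : vhom P2 N2) x,
    tf_map (vcomp f' f) (vcomp g1 g1') (vcomp g2 g2') x =
    tf_map f' g1' g2' (tf_map f g1 g2 x);
  tf_linear0 : forall M0 M1 M2 N0 N1 N2
    (g1 : vhom N1 M1) (g2 : vhom N2 M2) (x : tf_obj M0 M1 M2),
    linear (fun f : vhom M0 N0 => tf_map f g1 g2 x);
  tf_linear1 : forall M0 M1 M2 N0 N1 N2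
    (f : vhom M0 N0) (g2 : vhom N2 M2) (x : tf_obj M0 M1 M2),
    linear (fun g1 : vhom N1 M1 => tf_map f g1 g2 x);
  tf_linear2 : forall M0 M1 M2 N0 N1 N2
    (f : vhom M0 N0) (g1 : vhom N1 M1) (x : tf_obj M0 M1 M2),
    linear (fun g2 : vhom N2 M2 => tf_map f g1 g2 x) }.

Definition naturally_isomorphic (S T : trifunctor) : Prop :=
  exists eta : forall M0 M1 M2 : vmod,
      {linear tf_obj S M0 M1 M2 -> tf_obj T M0 M1 M2},
    (forall M0 M1 M2, bijective (eta M0 M1 M2)) /\
    (forall M0 M1 M2 N0 N1 N2
       (f : vhom M0 N0) (g1 : vhom N1 M1) (g2 : vhom N2 M2)
       (x : tf_obj S M0 M1 M2),
       eta N0 N1 N2 (tf_map S f g1 g2 x) = tf_map T f g1 g2 (eta M0 M1 M2 x)).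

End Modules.

(* [series M] is [M[[x^C, log x]]]: [f s k] is the coefficient of
   [x^s (log x)^k], and there is no condition on the support. *)
Definition series (M : lmodType C) : lmodType C := C -> nat -> M.

Section Series.
Context {M : lmodType C}.
Implicit Type f : series M.

Definition xmul (n : int) f : series M := fun s k => f (s - n%:~R) k.

(* multiplication by [(- x)^n] *)
Definition nxmul (n : int) f : series M := sgn n *: xmul n f.

Definition deriv f : series M := fun s k =>
  (s + 1) *: f (s + 1) k + k.+1%:R *: f (s + 1) k.+1.

Definition smap (N : lmodType C) (g : M -> N) f : series N :=
  fun s k => g (f s k).

(* [\sum_(k >= 0) f k = S], where each coefficient receives only finitely many
   nonzero contributions; finiteness is part of the assertion. *)
Definition series_sum (f : nat -> series M) (S : series M) : Prop :=
  forall s k, sum_is (fun i => f i s k) (S s k).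

(* [M[[x^C]][log x]] *)
Definition log_polynomial f : Prop :=
  exists K, forall s k, (K <= k)%N -> f s k = 0.

(* [M[[x]][x^C, log x]] *)
Definition log_laurent f : Prop :=
  exists (K : nat) (r : seq C), forall s k, f s k != 0 ->
    (k < K)%N /\ exists2 t, t \in r & exists n : nat, s = t + n%:R.

(* [M[x^C, log x]] *)
Definition log_finite f : Prop :=
  finite_set [set sk : C * nat | f sk.1 sk.2 != 0].

End Series.

Section SeriesTheory.
Context {M N : lmodType C}.

Lemma xmul_comb n c (f g : series M) :
  xmul n (c *: f + g) = c *: xmul n f + xmul n g.
Proof. by []. Qed.

Lemma nxmul_comb n c (f g : series M) :
  nxmul n (c *: f + g) = c *: nxmul n f + nxmul n g.
Proof. by rewrite /nxmul xmul_comb scalerDr !scalerA mulrC. Qed.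

Lemma deriv_comb c (f g : series M) :
  deriv (c *: f + g) = c *: deriv f + deriv g.
Proof.
apply/funext=> s; apply/funext=> k; rewrite /deriv !fct_combE.
by rewrite !scalerDr !scalerA ![_ * c]mulrC addrACA.
Qed.

Lemma smap_comb (h : M -> N) c (f g : series M) :
  linear h -> smap h (c *: f + g) = c *: smap h f + smap h g.
Proof. by move=> lh; apply/funext=> s; apply/funext=> k; exact: lh. Qed.

Lemma linear_eq0 (h : M -> N) : linear h -> h 0 = 0.
Proof.
by move=> lh; have := lh (-1) 0 0; rewrite scaler0 addr0 scaleN1r addNr.
Qed.

Lemma smap0 (h : M -> N) :
  linear h -> smap h (0 : series M) = 0.
Proof. by move=> lh; apply/funext=> s; apply/funext=> k; exact: linear_eq0. Qed.

Lemma xmul0 n : xmul n (0 : series M) = 0.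
Proof. by []. Qed.

Lemma nxmul0 n : nxmul n (0 : series M) = 0.
Proof. by rewrite /nxmul xmul0 scaler0. Qed.

Lemma deriv0 : deriv (0 : series M) = 0.
Proof.
apply/funext=> s; apply/funext=> k.
by rewrite /deriv !scaler0 addr0.
Qed.

Lemma smap_xmul (h : M -> N) n (f : series M) :
  smap h (xmul n f) = xmul n (smap h f).
Proof. by []. Qed.

Lemma smapZ (h : M -> N) c (f : series M) :
  linear h -> smap h (c *: f) = c *: smap h f.
Proof. by move=> lh; rewrite -[c *: f]addr0 smap_comb// smap0// addr0. Qed.

Lemma smapD (h : M -> N) (f g : series M) :
  linear h -> smap h (f + g) = smap h f + smap h g.
Proof. by move=> lh; rewrite -[f]scale1r smap_comb// !scale1r. Qed.

Lemma smapB (h : M -> N) (f g : series M) :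
  linear h -> smap h (f - g) = smap h f - smap h g.
Proof. by move=> lh; rewrite smapD// -scaleN1r smapZ// scaleN1r. Qed.

Lemma smap_nxmul (h : M -> N) n (f : series M) :
  linear h -> smap h (nxmul n f) = nxmul n (smap h f).
Proof. by move=> lh; rewrite /nxmul smapZ. Qed.

Lemma smap_deriv (h : M -> N) (f : series M) :
  linear h -> smap h (deriv f) = deriv (smap h f).
Proof.
move=> lh; apply/funext=> s; apply/funext=> k; rewrite /smap /deriv lh.
congr (_ + _); by rewrite -[_ *: f _ _]addr0 lh (linear_eq0 lh) addr0.
Qed.

Lemma series_sum0 (f : nat -> series M) : (forall k, f k = 0) -> series_sum f 0.
Proof. by move=> f0 s k; exists 0%N => n _; rewrite big1// => i _; rewrite f0. Qed.

Lemma series_sum_comb c (f g : nat -> series M) S T :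
  series_sum f S -> series_sum g T ->
  series_sum (fun k => c *: f k + g k) (c *: S + T).
Proof. by move=> fS gT s k; exact: sum_is_comb. Qed.

Lemma series_sum_map (h : M -> N) (f : nat -> series M) S :
  linear h -> series_sum f S -> series_sum (fun k => smap h (f k)) (smap h S).
Proof. by move=> lh fS s k; exact: (sum_is_lin lh). Qed.

Lemma log_finite0 : log_finite (0 : series M).
Proof.
by rewrite /log_finite (_ : [set _ | _] = set0)// -subset0 => x /=; rewrite eqxx.
Qed.

Lemma log_finite_comb c (f g : series M) :
  log_finite f -> log_finite g -> log_finite (c *: f + g).
Proof.
move=> ff gf; apply: (@sub_finite_set _ _ ([set sk | f sk.1 sk.2 != 0] `|`
  [set sk | g sk.1 sk.2 != 0])); last by rewrite finite_setU.
move=> [s k] /=; rewrite !fct_combE; have [->|] := eqVneq (f s k) 0; last by left.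
by rewrite scaler0 add0r; right.
Qed.

Lemma log_polynomial_comb c (f g : series M) :
  log_polynomial f -> log_polynomial g -> log_polynomial (c *: f + g).
Proof.
move=> [K fK] [K' gK]; exists (maxn K K') => s k; rewrite geq_max => /andP[Kk K'k].
by rewrite !fct_combE fK// gK// scaler0 addr0.
Qed.

Lemma log_laurent_comb c (f g : series M) :
  log_laurent f -> log_laurent g -> log_laurent (c *: f + g).
Proof.
move=> [K [r fK]] [K' [r' gK]]; exists (maxn K K'), (r ++ r') => s k.
rewrite !fct_combE; have [->|/fK[kK [t tr tn]] _] := eqVneq (f s k) 0; last first.
  by split; [rewrite leq_max kK | exists t; rewrite // mem_cat tr].
rewrite scaler0 add0r => /gK[kK [t tr tn]].
by split; [rewrite leq_max kK orbT | exists t; rewrite // mem_cat tr orbT].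
Qed.

Lemma log_polynomial_smap (h : M -> N) (f : series M) :
  linear h -> log_polynomial f -> log_polynomial (smap h f).
Proof.
by move=> lh [K fK]; exists K => s k Kk; rewrite /smap fK// linear_eq0.
Qed.

Lemma log_laurent_smap (h : M -> N) (f : series M) :
  linear h -> log_laurent f -> log_laurent (smap h f).
Proof.
move=> lh [K [r fK]]; exists K, r => s k hf; apply: fK.
by apply: contra_neq hf; rewrite /smap => ->; rewrite linear_eq0.
Qed.

End SeriesTheory.

Section IntertwiningOperators.
Context {V : voa}.

Section Log.
Context (M0 M1 M2 : vmod V).

(* [Y m1 s k] is the coefficient of [z^s (log z)^k] in [Y(m1, z)], as a map
   [M2 -> M0]; [series_at Y m1 m2] is [Y(m1, z) m2].
   Identities in [Hom(M2, M0)] are stated after application to [m2], since their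
   sums over [k] are finite only pointwise. *)
Definition log_data : lmodType C := M1 -> series (M2 -> M0 : lmodType C).

Definition series_at (Y : log_data) (m1 : M1) (m2 : M2) : series M0 :=
  smap (fun g : M2 -> M0 => g m2) (Y m1).

Record is_log_intertwiner (Y : log_data) : Prop := IsLogIntertwiner {
  Ilog_linear : linear Y;
  Ilog_linear_coef : forall m1 s k, linear (Y m1 s k);
  Ilog_log_polynomial : forall m1, log_polynomial (Y m1);
  Ilog_I1 : forall m1 m2, log_laurent (series_at Y m1 m2);
  Ilog_I2 : forall m1 m2,
    smap (Lmode (-1)) (series_at Y m1 m2) - series_at Y m1 (Lmode (-1) m2) =
    deriv (series_at Y m1 m2);
  Ilog_I3_commutator : forall a (n : int) m1 m2,
    series_sum
      (fun k : nat => binz n k *: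
         xmul (n - k%:Z) (series_at Y (act a k%:Z m1) m2))
      (smap (act a n) (series_at Y m1 m2) - series_at Y m1 (act a n m2));
  Ilog_I3_iterate : forall a (n : int) m1 m2,
    series_sum
      (fun k : nat => binz n k *:
         (nxmul k%:Z (smap (act a (n - k%:Z)) (series_at Y m1 m2))
          - nxmul (n - k%:Z) (series_at Y m1 (act a k%:Z m2))))
      (series_at Y (act a n m1) m2) }.

End Log.

Section Parenthesized.
Context (M0 M1 M2 : vmod V).

(* Linear maps on [M1 (x) M2] are represented as bilinear maps. *)
Definition PI12_data : lmodType C := M1 -> M2 -> series M0.

Record is_PI12 (F : PI12_data) : Prop := IsPI12 {
  PI12_linearl : forall m2, linear (F^~ m2);
  PI12_linearr : forall m1, linear (F m1);
  PI12_0 : forall (u : M0 -> C^o), restricted_dual u ->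
    forall m1 m2, log_finite (smap u (F m1 m2));
  PI12_1 : forall m1 m2, F (Lmode (-1) m1) m2 = deriv (F m1 m2);
  PI12_2l : forall a (n : int) m1 m2, exists S1 S2 : series M0,
    [/\ series_sum (fun k : nat => binz n k *:
          nxmul k%:Z (smap (act a (n - k%:Z)) (F m1 m2))) S1,
        series_sum (fun k : nat => binz n k *:
          nxmul (n - k%:Z) (F m1 (act a k%:Z m2))) S2
      & F (act a n m1) m2 = S1 - S2];
  PI12_2r : forall a (n : int) m1 m2, exists S : series M0,
    series_sum (fun k : nat => binz n k *:
      xmul (n - k%:Z) (F (act a k%:Z m1) m2)) S /\
    F m1 (act a n m2) = smap (act a n) (F m1 m2) - S }.

End Parenthesized.
End IntertwiningOperators.

Section Functors.
Context (V : voa).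
Implicit Types M N : vmod V.

Lemma act_linear (M : vmod V) a n : linear (@act V M a n).
Proof. exact: (act_linearr (vmod_laws M)). Qed.

Lemma Lmode_linear (M : vmod V) n : linear (@Lmode V M n).
Proof. exact: act_linear. Qed.

Lemma vhom_linear M N (f : vhom M N) : linear (vhom_fun f).
Proof. by case: (vhomP f). Qed.

Lemma vhom_act M N (f : vhom M N) a n m :
  vhom_fun f (act a n m) = act a n (vhom_fun f m).
Proof. by case: (vhomP f). Qed.

Lemma vhom_Lmode M N (f : vhom M N) n m :
  vhom_fun f (Lmode n m) = Lmode n (vhom_fun f m).
Proof. exact: vhom_act. Qed.

Lemma vhom_smap_act M N (f : vhom M N) a n (g : series M) :
  smap (vhom_fun f) (smap (act a n) g) = smap (act a n) (smap (vhom_fun f) g).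
Proof. by apply/funext=> s; apply/funext=> k; exact: vhom_act. Qed.

Lemma vhom_weight_space M N (f : vhom M N) h m :
  weight_space h m -> weight_space h (vhom_fun f m).
Proof.
move=> [n fn]; exists n; move: fn; rewrite /nilpotent_at.
set D := fun v : M => _; set E := fun v : N => _.
have DE k : vhom_fun f (iter k D m) = iter k E (vhom_fun f m).
  elim: k => //= k <-; rewrite /D /E.
  rewrite -scaleNr addrC (vhom_linear f) scaleNr addrC.
  by rewrite (vhom_Lmode f).
by rewrite -DE => ->; apply: linear_eq0; exact: vhom_linear.
Qed.

Lemma vhom_restricted_dual M N (f : vhom M N) (u : N -> C) :
  restricted_dual u -> restricted_dual (u \o vhom_fun f).
Proof.
move=> [lu fu]; split; first by move=> c x y /=; rewrite (vhom_linear f) lu.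
apply: sub_finite_set fu => h [m wm um]; exists (vhom_fun f m) => //.
exact: vhom_weight_space.
Qed.

Section PI12.
Context {M0 M1 M2 : vmod V}.
Local Notation data := (PI12_data M0 M1 M2).

Lemma is_PI12_0 : is_PI12 (0 : data).
Proof.
split.
- by move=> m2 c x y /=; rewrite scaler0 addr0.
- by move=> m1 c x y /=; rewrite scaler0 addr0.
- move=> u [lu _] m1 m2.
  by rewrite (smap0 (h := u : M0 -> C^o))//; exact: log_finite0.
- by move=> m1 m2; rewrite deriv0.
- move=> a n m1 m2; exists 0, 0; split.
  + apply: series_sum0 => k.
    by rewrite (smap0 (@act_linear _ _ _)) nxmul0 scaler0.
  + by apply: series_sum0 => k; rewrite nxmul0 scaler0.
  + by rewrite subr0.
- move=> a n m1 m2; exists 0; split.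
  + by apply: series_sum0 => k; rewrite xmul0 scaler0.
  + by rewrite (smap0 (@act_linear _ _ _)) subr0.
Qed.

Lemma is_PI12_comb (c : C) (F G : data) :
  is_PI12 F -> is_PI12 G -> is_PI12 (c *: F + G).
Proof.
have combA (d : C) (U : lmodType C) (a b e h : U) :
    c *: (d *: a + b) + (d *: e + h) = d *: (c *: a + e) + (c *: b + h).
  by rewrite !scalerDr !scalerA [d * c]mulrC addrACA.
have combB (U : lmodType C) (a b e h : U) :
    c *: (a - b) + (e - h) = (c *: a + e) - (c *: b + h).
  by rewrite scalerBr opprD addrACA.
move=> [Fl Fr F0 F1 F2l F2r] [Gl Gr G0 G1 G2l G2r]; split.
- move=> m2 d x y; rewrite !fct_combE.
  by rewrite (Fl m2) (Gl m2) combA.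
- by move=> m1 d x y; rewrite !fct_combE (Fr m1) (Gr m1) combA.
- move=> u ru m1 m2; have lu := ru.1.
  rewrite !fct_combE (smap_comb (h := u : M0 -> C^o))//.
  by apply: log_finite_comb; [exact: F0|exact: G0].
- by move=> m1 m2; rewrite !fct_combE deriv_comb F1 G1.
- move=> a n m1 m2; rewrite !fct_combE.
  have [S1 [S2 [h1 h2 ->]]] := F2l a n m1 m2.
  have [T1 [T2 [k1 k2 ->]]] := G2l a n m1 m2.
  exists (c *: S1 + T1), (c *: S2 + T2); split; last exact: combB.
  + have := series_sum_comb c h1 k1; congr (series_sum _ _).
    apply/funext=> k; rewrite (smap_comb _ _ _ (@act_linear _ _ _)).
    by rewrite nxmul_comb scalerDr !scalerA [c * _]mulrC.
  + have := series_sum_comb c h2 k2; congr (series_sum _ _).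
    apply/funext=> k; rewrite !fct_combE.
    by rewrite nxmul_comb scalerDr !scalerA [c * _]mulrC.
- move=> a n m1 m2; have [S [h1 e]] := F2r a n m1 m2.
  have [T [k1 e']] := G2r a n m1 m2.
  exists (c *: S + T); split.
    have := series_sum_comb c h1 k1; congr (series_sum _ _).
    apply/funext=> k; rewrite !fct_combE.
    by rewrite xmul_comb scalerDr !scalerA [c * _]mulrC.
  rewrite !fct_combE e e' (smap_comb _ _ _ (@act_linear _ _ _)).
  exact: combB.
Qed.

End PI12.

Definition PI12_space (M0 M1 M2 : vmod V) : subspace (PI12_data M0 M1 M2) :=
  Subspace (@is_PI12_0 M0 M1 M2) (@is_PI12_comb M0 M1 M2).

Definition PI12_obj (M0 M1 M2 : vmod V) : lmodType C :=
  subspace_type (PI12_space M0 M1 M2).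

Section PI12Map.
Context {M0 M1 M2 N0 N1 N2 : vmod V}.
Variables (f : vhom M0 N0) (g1 : vhom N1 M1) (g2 : vhom N2 M2).

Definition PI12_push (F : PI12_data M0 M1 M2) : PI12_data N0 N1 N2 :=
  fun n1 n2 => smap (vhom_fun f) (F (vhom_fun g1 n1) (vhom_fun g2 n2)).

Lemma PI12_pushP F : is_PI12 F -> is_PI12 (PI12_push F).
Proof.
have lf := vhom_linear f; have lg1 := vhom_linear g1.
have lg2 := vhom_linear g2.
move=> [Fl Fr F0 F1 F2l F2r]; split.
- by move=> m2 d x y; rewrite /PI12_push lg1 (Fl _) smap_comb.
- by move=> m1 d x y; rewrite /PI12_push lg2 (Fr _) smap_comb.
- move=> u ru m1 m2; exact: (F0 _ (vhom_restricted_dual f ru)).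
- by move=> m1 m2; rewrite /PI12_push vhom_Lmode F1 smap_deriv.
- move=> a n m1 m2; rewrite /PI12_push vhom_act.
  have [S1 [S2 [h1 h2 ->]]] := F2l a n (vhom_fun g1 m1) (vhom_fun g2 m2).
  exists (smap (vhom_fun f) S1), (smap (vhom_fun f) S2).
  split; last by rewrite smapB.
  + have := series_sum_map lf h1; congr (series_sum _ _); apply/funext=> k.
    by rewrite smapZ// smap_nxmul// vhom_smap_act.
  + have := series_sum_map lf h2; congr (series_sum _ _); apply/funext=> k.
    by rewrite smapZ// smap_nxmul// vhom_act.
- move=> a n m1 m2; rewrite /PI12_push vhom_act.
  have [S [h1 ->]] := F2r a n (vhom_fun g1 m1) (vhom_fun g2 m2).
  exists (smap (vhom_fun f) S); split; last by rewrite smapB// vhom_smap_act.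
  have := series_sum_map lf h1; congr (series_sum _ _); apply/funext=> k.
  by rewrite smapZ// smap_xmul vhom_act.
Qed.

Definition PI12_map (F : PI12_obj M0 M1 M2) : PI12_obj N0 N1 N2 :=
  mk_elt (S := PI12_space N0 N1 N2)
    (PI12_pushP (elt_in (S := PI12_space M0 M1 M2) F)).

Lemma PI12_map_linear : linear PI12_map.
Proof.
move=> c F G; apply: (@elt_inj _ _ (PI12_space N0 N1 N2)).
rewrite elt_linear /PI12_map !elt_mk elt_linear.
apply/funext=> m1; apply/funext=> m2.
by rewrite /PI12_push !fct_combE (smap_comb _ _ _ (vhom_linear f)).
Qed.

HB.instance Definition _ := GRing.isLinear.Build C _ _ _ PI12_map
  PI12_map_linear.

End PI12Map.

Section PI12Laws.
Context {M0 M1 M2 N0 N1 N2 : vmod V}.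

Lemma PI12_id (x : PI12_obj M0 M1 M2) :
  PI12_map (vid M0) (vid M1) (vid M2) x = x.
Proof. by apply: (@elt_inj _ _ (PI12_space M0 M1 M2)); rewrite elt_mk. Qed.

Lemma PI12_comp (P0 P1 P2 : vmod V)
  (f : vhom M0 N0) (g1 : vhom N1 M1) (g2 : vhom N2 M2)
  (f' : vhom N0 P0) (g1' : vhom P1 N1) (g2' : vhom P2 N2) x :
  PI12_map (vcomp f' f) (vcomp g1 g1') (vcomp g2 g2') x =
  PI12_map f' g1' g2' (PI12_map f g1 g2 x).
Proof. by apply: (@elt_inj _ _ (PI12_space P0 P1 P2)); rewrite !elt_mk. Qed.

Lemma PI12_linear0 (g1 : vhom N1 M1) (g2 : vhom N2 M2) x :
  linear (fun f : vhom M0 N0 => PI12_map f g1 g2 x).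
Proof.
move=> c f f'; apply: (@elt_inj _ _ (PI12_space N0 N1 N2)).
by rewrite elt_linear !elt_mk.
Qed.

Lemma PI12_linear1 (f : vhom M0 N0) (g2 : vhom N2 M2) x :
  linear (fun g1 : vhom N1 M1 => PI12_map f g1 g2 x).
Proof.
move=> c g g'; apply: (@elt_inj _ _ (PI12_space N0 N1 N2)).
rewrite elt_linear !elt_mk.
have [Fl _ _ _ _ _] := elt_in (S := PI12_space M0 M1 M2) x.
apply/funext=> n1; apply/funext=> n2; rewrite !fct_combE /PI12_push.
have -> : vhom_fun (c *: g + g') = c *: vhom_fun g + vhom_fun g' by [].
by rewrite fct_combE (Fl (vhom_fun g2 n2)) (smap_comb _ _ _ (vhom_linear f)).
Qed.

Lemma PI12_linear2 (f : vhom M0 N0) (g1 : vhom N1 M1) x :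
  linear (fun g2 : vhom N2 M2 => PI12_map f g1 g2 x).
Proof.
move=> c g g'; apply: (@elt_inj _ _ (PI12_space N0 N1 N2)).
rewrite elt_linear !elt_mk.
have [_ Fr _ _ _ _] := elt_in (S := PI12_space M0 M1 M2) x.
apply/funext=> n1; apply/funext=> n2; rewrite !fct_combE /PI12_push.
have -> : vhom_fun (c *: g + g') = c *: vhom_fun g + vhom_fun g' by [].
by rewrite fct_combE Fr (smap_comb _ _ _ (vhom_linear f)).
Qed.

End PI12Laws.

Definition PI12 : trifunctor V := {|
  tf_obj := PI12_obj;
  tf_map M0 M1 M2 N0 N1 N2 f g1 g2 := PI12_map f g1 g2;
  tf_id := @PI12_id;
  tf_comp := @PI12_comp;
  tf_linear0 := @PI12_linear0;
  tf_linear1 := @PI12_linear1;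
  tf_linear2 := @PI12_linear2 |}.

Section Ilog.
Context {M0 M1 M2 : vmod V}.
Local Notation data := (log_data M0 M1 M2).

Lemma series_at_comb c (Y Z : data) m1 m2 :
  series_at (c *: Y + Z) m1 m2 = c *: series_at Y m1 m2 + series_at Z m1 m2.
Proof. by []. Qed.

Lemma is_log_intertwiner_0 : is_log_intertwiner (0 : data).
Proof.
have at0 m1 m2 : series_at (0 : data) m1 m2 = 0 by [].
split.
- by move=> c x y /=; rewrite scaler0 addr0.
- by move=> m1 s k c x y /=; rewrite scaler0 addr0.
- by move=> m1; exists 0%N.
- by move=> m1 m2; exists 0%N, [::] => s k; rewrite at0 eqxx.
- by move=> m1 m2; rewrite !at0 (smap0 (@Lmode_linear _ _)) subr0 deriv0.
- move=> a n m1 m2; rewrite !at0 (smap0 (@act_linear _ _ _)) subr0.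
  by apply: series_sum0 => k; rewrite xmul0 scaler0.
- move=> a n m1 m2; apply: series_sum0 => k.
  by rewrite !at0 (smap0 (@act_linear _ _ _)) !nxmul0 subr0 scaler0.
Qed.

Lemma is_log_intertwiner_comb (c : C) (Y Z : data) :
  is_log_intertwiner Y -> is_log_intertwiner Z ->
  is_log_intertwiner (c *: Y + Z).
Proof.
have combA (d : C) (U : lmodType C) (a b e h : U) :
    c *: (d *: a + b) + (d *: e + h) = d *: (c *: a + e) + (c *: b + h).
  by rewrite !scalerDr !scalerA [d * c]mulrC addrACA.
have combB (U : lmodType C) (a b e h : U) :
    c *: (a - b) + (e - h) = (c *: a + e) - (c *: b + h).
  by rewrite scalerBr opprD addrACA.
move=> [Yl Yc Yp Y1 Y2 Y3c Y3i] [Zl Zc Zp Z1 Z2 Z3c Z3i]; split.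
- by move=> d x y; rewrite !fct_combE Yl Zl combA.
- by move=> m1 s k d x y; rewrite !fct_combE (Yc m1 s k) (Zc m1 s k) combA.
- by move=> m1; rewrite fct_combE; exact: log_polynomial_comb.
- by move=> m1 m2; rewrite series_at_comb; exact: log_laurent_comb.
- move=> m1 m2; rewrite !series_at_comb deriv_comb -Y2 -Z2.
  by rewrite (smap_comb _ _ _ (@Lmode_linear _ _)) combB.
- move=> a n m1 m2; rewrite !series_at_comb.
  rewrite (smap_comb _ _ _ (@act_linear _ _ _)) -combB.
  have := series_sum_comb c (Y3c a n m1 m2) (Z3c a n m1 m2).
  congr (series_sum _ _); apply/funext=> k; rewrite series_at_comb.
  by rewrite xmul_comb scalerDr !scalerA [c * _]mulrC.
- move=> a n m1 m2; rewrite !series_at_comb.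
  have := series_sum_comb c (Y3i a n m1 m2) (Z3i a n m1 m2).
  congr (series_sum _ _); apply/funext=> k; rewrite !series_at_comb.
  rewrite (smap_comb _ _ _ (@act_linear _ _ _)) !nxmul_comb -combB.
  by rewrite [RHS]scalerDr !scalerA [c * _]mulrC.
Qed.

End Ilog.

Definition Ilog_space (M0 M1 M2 : vmod V) : subspace (log_data M0 M1 M2) :=
  Subspace (@is_log_intertwiner_0 M0 M1 M2) (@is_log_intertwiner_comb M0 M1 M2).

Definition Ilog_obj (M0 M1 M2 : vmod V) : lmodType C :=
  subspace_type (Ilog_space M0 M1 M2).

Section IlogMap.
Context {M0 M1 M2 N0 N1 N2 : vmod V}.
Variables (f : vhom M0 N0) (g1 : vhom N1 M1) (g2 : vhom N2 M2).

Definition Ilog_push (Y : log_data M0 M1 M2) : log_data N0 N1 N2 :=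
  fun n1 s k n2 => vhom_fun f (Y (vhom_fun g1 n1) s k (vhom_fun g2 n2)).

Lemma series_at_push Y n1 n2 : series_at (Ilog_push Y) n1 n2 =
  smap (vhom_fun f) (series_at Y (vhom_fun g1 n1) (vhom_fun g2 n2)).
Proof. by []. Qed.

Lemma Ilog_pushP Y : is_log_intertwiner Y -> is_log_intertwiner (Ilog_push Y).
Proof.
have lf := vhom_linear f; have lg1 := vhom_linear g1.
have lg2 := vhom_linear g2.
move=> [Yl Yc Yp Y1 Y2 Y3c Y3i]; split.
- move=> d x y; rewrite /Ilog_push lg1 Yl; apply/funext=> s; apply/funext=> k.
  by apply/funext=> n2; exact: lf.
- by move=> m1 s k d x y; rewrite /Ilog_push lg2 (Yc _ _ _) lf.
- move=> m1; have [K YK] := Yp (vhom_fun g1 m1); exists K => s k Kk.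
  by apply/funext=> n2; rewrite /Ilog_push YK//; exact: linear_eq0.
- by move=> m1 m2; rewrite series_at_push; exact: log_laurent_smap.
- move=> m1 m2; rewrite !series_at_push vhom_Lmode -smap_deriv// -Y2 smapB//.
  by congr (_ - _); rewrite /Lmode /Lop vhom_smap_act.
- move=> a n m1 m2; rewrite !series_at_push vhom_act -vhom_smap_act -smapB//.
  have := series_sum_map lf (Y3c a n (vhom_fun g1 m1) (vhom_fun g2 m2)).
  congr (series_sum _ _); apply/funext=> k.
  by rewrite series_at_push smapZ// smap_xmul vhom_act.
- move=> a n m1 m2; rewrite !series_at_push vhom_act.
  have := series_sum_map lf (Y3i a n (vhom_fun g1 m1) (vhom_fun g2 m2)).
  congr (series_sum _ _); apply/funext=> k.
  by rewrite !series_at_push smapZ// smapB// !smap_nxmul// vhom_smap_act vhom_act.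
Qed.

Definition Ilog_map (Y : Ilog_obj M0 M1 M2) : Ilog_obj N0 N1 N2 :=
  mk_elt (S := Ilog_space N0 N1 N2)
    (Ilog_pushP (elt_in (S := Ilog_space M0 M1 M2) Y)).

Lemma Ilog_map_linear : linear Ilog_map.
Proof.
move=> c Y Z; apply: (@elt_inj _ _ (Ilog_space N0 N1 N2)).
rewrite elt_linear /Ilog_map !elt_mk elt_linear.
apply/funext=> m1; apply/funext=> s; apply/funext=> k; apply/funext=> m2.
by rewrite /Ilog_push !fct_combE (vhom_linear f).
Qed.

HB.instance Definition _ := GRing.isLinear.Build C _ _ _ Ilog_map
  Ilog_map_linear.

End IlogMap.

Section IlogLaws.
Context {M0 M1 M2 N0 N1 N2 : vmod V}.

Lemma Ilog_id (x : Ilog_obj M0 M1 M2) :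
  Ilog_map (vid M0) (vid M1) (vid M2) x = x.
Proof. by apply: (@elt_inj _ _ (Ilog_space M0 M1 M2)); rewrite elt_mk. Qed.

Lemma Ilog_comp (P0 P1 P2 : vmod V)
  (f : vhom M0 N0) (g1 : vhom N1 M1) (g2 : vhom N2 M2)
  (f' : vhom N0 P0) (g1' : vhom P1 N1) (g2' : vhom P2 N2) x :
  Ilog_map (vcomp f' f) (vcomp g1 g1') (vcomp g2 g2') x =
  Ilog_map f' g1' g2' (Ilog_map f g1 g2 x).
Proof. by apply: (@elt_inj _ _ (Ilog_space P0 P1 P2)); rewrite !elt_mk. Qed.

Lemma Ilog_linear0 (g1 : vhom N1 M1) (g2 : vhom N2 M2) x :
  linear (fun f : vhom M0 N0 => Ilog_map f g1 g2 x).
Proof.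
move=> c f f'; apply: (@elt_inj _ _ (Ilog_space N0 N1 N2)).
by rewrite elt_linear !elt_mk.
Qed.

Lemma Ilog_linear1 (f : vhom M0 N0) (g2 : vhom N2 M2) x :
  linear (fun g1 : vhom N1 M1 => Ilog_map f g1 g2 x).
Proof.
move=> c g g'; apply: (@elt_inj _ _ (Ilog_space N0 N1 N2)).
rewrite elt_linear !elt_mk.
have [Yl _ _ _ _ _ _] := elt_in (S := Ilog_space M0 M1 M2) x.
apply/funext=> n1; apply/funext=> s; apply/funext=> k; apply/funext=> n2.
rewrite !fct_combE /Ilog_push.
have -> : vhom_fun (c *: g + g') = c *: vhom_fun g + vhom_fun g' by [].
by rewrite fct_combE Yl !fct_combE (vhom_linear f).
Qed.

Lemma Ilog_linear2 (f : vhom M0 N0) (g1 : vhom N1 M1) x :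
  linear (fun g2 : vhom N2 M2 => Ilog_map f g1 g2 x).
Proof.
move=> c g g'; apply: (@elt_inj _ _ (Ilog_space N0 N1 N2)).
rewrite elt_linear !elt_mk.
have [_ Yc _ _ _ _ _] := elt_in (S := Ilog_space M0 M1 M2) x.
apply/funext=> n1; apply/funext=> s; apply/funext=> k; apply/funext=> n2.
rewrite !fct_combE /Ilog_push.
have -> : vhom_fun (c *: g + g') = c *: vhom_fun g + vhom_fun g' by [].
by rewrite fct_combE (Yc _ s k) (vhom_linear f).
Qed.

End IlogLaws.

Definition Ilog : trifunctor V := {|
  tf_obj := Ilog_obj;
  tf_map M0 M1 M2 N0 N1 N2 f g1 g2 := Ilog_map f g1 g2;
  tf_id := @Ilog_id;
  tf_comp := @Ilog_comp;
  tf_linear0 := @Ilog_linear0;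
  tf_linear1 := @Ilog_linear1;
  tf_linear2 := @Ilog_linear2 |}.

End Functors.
End Vertex.

Arguments voa : clear implicits.

(* Main.v *)
Require Import Defs.
From HB Require Import structures.
From mathcomp Require Import all_boot all_order all_algebra.
From mathcomp Require Import finmap all_classical all_reals.
From mathcomp Require Import complex zify.

(** Both functors consist of families of coefficients F_{s,k}(m1, m2) in M0,
    standing for F(m1, m2) = sum of F_{s,k}(m1, m2) x^s (log x)^k, and the
    isomorphism [exchange] only reorders the arguments. Naturality and
    linearity then hold by computation; the content is that the two sets of
    axioms are equivalent. The commutator formulas are the same up to moving
    terms across the equality, the iterate formulas differ by splitting one
    sum into two, and (I2) and (PI1) are exchanged by the commutator formula
    for omega(0) = L(-1). What remains are the conditions on supports: (PI0)
    tests F(m1, m2) against the restricted dual of M0, whereas an intertwining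
    operator has an expansion in M0[[x]][x^C, log x], with a bound on the
    powers of log x that does not depend on m2.

    These are reconciled by the action of L(0). The commutator formula for
    omega(1) = L(0), together with (PI1), gives [L0_derivation]:

      L(0) F_{s,k}(m1, m2) = F_{s,k}(L(0) m1, m2) + F_{s,k}(m1, L(0) m2)
                             + s F_{s,k}(m1, m2) + (k+1) F_{s,k+1}(m1, m2).

    Suppose that m1 and m2 have generalized weights h1 and h2, and put
    c = h1 + h2 + s.

    - [component_eq0], [weight_coefficient]: F_{s,k}(m1, m2) has generalized
      weight c. By induction on the nilpotency orders of m1 and m2, the
      component w_k of F_{s,k}(m1, m2) in another weight space satisfies
      (L(0) - c) w_k = (k+1) w_{k+1}. Since w_k = 0 for large k, and L(0) - c
      is injective on that weight space, descending in k gives w_k = 0.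
      Either support condition makes w_k vanish for large k: for (PI0) because
      finitely many elements of the restricted dual separate the points of a
      finite-dimensional weight space ([span_coordinates]).

    - [log_degree_bound], [log_bound]: read in the other direction, the identity
      expresses (k+1) F_{s,k+1} by operators that are nilpotent on the weight
      spaces, of orders bounded uniformly in the weights. So the powers of
      log x are bounded uniformly in m1, m2 and s.

    Conversely, these two facts give both support conditions. A nonzero
    F_{s,k}(m1, m2) forces c to be a weight of M0, and the weights of M0 lie in
    finitely many sets Delta_i + N ([log_laurent_operator]). An element of the
    restricted dual vanishes on all but finitely many weight spaces, hence sees
    only finitely many s ([log_finite_operator]). *)

Set Implicit Arguments.
Unset Strict Implicit.
Unset Printing Implicit Defensive.

Import Order.TTheory GRing.Theory Num.Theory.
Local Open Scope classical_set_scope.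
Local Open Scope ring_scope.

(** * Linear maps, finite sums and spans *)

Section UnbundledLinearMaps.
Context {K : fieldType} {U W : lmodType K} (g : U -> W).
Hypothesis g_linear : linear g.

Lemma linear_fun0 : g 0 = 0.
Proof.
by have := g_linear (-1) 0 0; rewrite scaler0 addr0 scaleN1r addNr.
Qed.

Lemma linear_funD u v : g (u + v) = g u + g v.
Proof. by have := g_linear 1 u v; rewrite !scale1r. Qed.

Lemma linear_funZ c u : g (c *: u) = c *: g u.
Proof. by have := g_linear c u 0; rewrite linear_fun0 !addr0. Qed.

Lemma linear_funB u v : g (u - v) = g u - g v.
Proof. by rewrite linear_funD -scaleN1r linear_funZ scaleN1r. Qed.

End UnbundledLinearMaps.

Section FiniteSums.
Context {K : fieldType} {U : lmodType K}.
Implicit Types f g : nat -> U.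

Lemma sum_is_unique f s t : sum_is f s -> sum_is f t -> s = t.
Proof.
move=> [N fN] [N' fN']; rewrite -(fN (maxn N N')) ?leq_maxl//.
by rewrite -(fN' (maxn N N')) ?leq_maxr.
Qed.

Lemma sum_is_truncated f N :
  (forall i, (N <= i)%N -> f i = 0) -> sum_is f (\sum_(k < N) f k).
Proof.
move=> f0; exists N => n Nn.
rewrite -(subnKC Nn) big_split_ord /= [X in _ + X]big1 ?addr0// => i _.
by rewrite f0 ?leq_addr.
Qed.

End FiniteSums.

Section Span.
Context {K : fieldType} {U : lmodType K}.
Implicit Types (e : seq U) (x y : U).

Lemma spanned_by_comb e (c : K) x y :
  spanned_by e x -> spanned_by e y -> spanned_by e (c *: x + y).
Proof.
move=> [a ->] [b ->]; exists (fun i => c * a i + b i).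
rewrite scaler_sumr -big_split; apply: eq_bigr => i _ /=.
by rewrite scalerDl scalerA.
Qed.

Lemma spanned_by_cons x e y :
  spanned_by (x :: e) y <-> exists a z, spanned_by e z /\ y = a *: x + z.
Proof.
split=> [[c ->]|[a [z [[c ->] ->]]]].
  exists (c 0%N), (\sum_(i < size e) c i.+1 *: e`_i).
  by split; [exists (fun i => c i.+1) | rewrite big_ord_recl].
by exists (fun i => if i is j.+1 then c j else a); rewrite big_ord_recl.
Qed.

(** Finitely many linear forms separate the points of a finite-dimensional
    space. A spanning family need not be free, so the forms are built by adding
    one vector at a time: a vector outside the span of the previous ones
    contributes its coefficient as a new form, and the previous forms are
    evaluated after subtracting its multiple. *)
Lemma span_coordinates e : exists (n : nat) (u : nat -> U -> K),
  (forall j c x y, spanned_by e x -> spanned_by e y ->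
     u j (c *: x + y) = c * u j x + u j y) /\
  (forall x, spanned_by e x -> (forall j, (j < n)%N -> u j x = 0) -> x = 0).
Proof.
elim: e => [|x e [n [u [u_lin u_inj]]]].
  exists 0%N, (fun _ _ => 0); split=> [j c y z _ _|y [c ->] _].
    by rewrite mulr0 addr0.
  by rewrite big_ord0.
have [ex|nex] := pselect (spanned_by e x).
  have sub y : spanned_by (x :: e) y -> spanned_by e y.
    by move=> /spanned_by_cons[a [z [ez ->]]]; exact: spanned_by_comb.
  by exists n, u; split=> [j c y z /sub ey /sub ez|y /sub]; [exact: u_lin | exact: u_inj].
(* As x is not in the span of e, its coefficient in a sum a x + y is unique. *)
have uniq_coef a b y z : spanned_by e y -> spanned_by e z ->
    a *: x + y = b *: x + z -> a = b.
  move=> ey ez /eqP; rewrite -subr_eq => /eqP abx.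
  apply/eqP; rewrite -subr_eq0; apply/negP => /negP ab0; apply: nex.
  have -> : x = (a - b)^-1 *: ((-1) *: y + z) + 0.
    rewrite addr0 scaleN1r [- y + z]addrC.
    have -> : z - y = (a - b) *: x.
      by rewrite scalerBl -abx -addrA opprD addNKr opprB.
    by rewrite scalerA mulVf// scale1r.
  apply: spanned_by_comb; first exact: spanned_by_comb.
  exists (fun=> 0); by rewrite big1// => i _; rewrite scale0r.
have /choice[al alP] : forall y, exists a : K,
    spanned_by (x :: e) y -> spanned_by e (y - a *: x).
  move=> y; have [/spanned_by_cons[a [z [ez ->]]]|ny] :=
    pselect (spanned_by (x :: e) y); last by exists 0.
  by exists a => _; rewrite addrC addKr.
have decomp y : y = al y *: x + (y - al y *: x) by rewrite addrC subrK.
have al_lin c y z : spanned_by (x :: e) y -> spanned_by (x :: e) z ->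
    al (c *: y + z) = c * al y + al z.
  move=> ey ez; apply: (@uniq_coef _ _ (c *: y + z - al (c *: y + z) *: x)
      (c *: (y - al y *: x) + (z - al z *: x))).
  - by apply: alP; exact: spanned_by_comb.
  - by apply: spanned_by_comb; exact: alP.
  - rewrite -decomp [in LHS](decomp y) [in LHS](decomp z).
    by rewrite scalerDr scalerDl scalerA addrACA.
exists n.+1, (fun j y => if j is k.+1 then u k (y - al y *: x) else al y).
split=> [[|j] c y z ey ez|y ey uy0].
- exact: al_lin.
- rewrite al_lin// -u_lin; [|exact: alP..].
  congr (u j _); rewrite scalerBr scalerDl scalerA opprD addrACA //.
- have al0 : al y = 0 by exact: (uy0 0%N).
  have := alP _ ey; rewrite al0 scale0r subr0 => ey'.
  apply: u_inj => // j jn.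
  by have := uy0 j.+1 jn; rewrite al0 scale0r subr0.
Qed.

End Span.

(** * Generalized eigenspaces and their projections *)

Section GeneralizedEigenspaces.
Context {K : fieldType} {U : lmodType K} (T : {linear U -> U}).
Implicit Types (h c : K) (u v : U) (N : nat).

Definition shift h v : U := T v - h *: v.

Lemma shift_is_linear h : linear (shift h).
Proof.
move=> c u v; rewrite /shift linearP scalerDr scalerBr opprD !scalerA.
by rewrite [h * c]mulrC addrACA.
Qed.

HB.instance Definition _ h := GRing.isLinear.Build K U U _ (shift h)
  (shift_is_linear h).

Lemma shiftE h c u : shift c u = shift h u + (h - c) *: u.
Proof. by rewrite /shift scalerBl addrA subrK. Qed.

Lemma iter_shift_linear h N : linear (iter N (shift h)).
Proof.
by move=> c u v; elim: N => //= N ->; rewrite linearP.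
Qed.

HB.instance Definition _ h N := GRing.isLinear.Build K U U _ (iter N (shift h))
  (iter_shift_linear h N).

Lemma shift_comm h c u : shift h (shift c u) = shift c (shift h u).
Proof.
by rewrite [RHS](shiftE h) (shiftE h c u) linearD linearZ.
Qed.

Lemma nilpotent_atE h N u : nilpotent_at T h N u = (iter N (shift h) u = 0).
Proof. by []. Qed.

Lemma nilpotent_at_leq h N N' u :
  (N <= N')%N -> nilpotent_at T h N u -> nilpotent_at T h N' u.
Proof.
by move=> NN'; rewrite !nilpotent_atE -(subnK NN') iterD => ->; rewrite linear0.
Qed.

Lemma nilpotent_at_shift h c N u :
  nilpotent_at T h N u -> nilpotent_at T h N (shift c u).
Proof.
rewrite !nilpotent_atE => uN.
have -> : iter N (shift h) (shift c u) = shift c (iter N (shift h) u).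
  by elim: N {uN} => //= N ->; rewrite shift_comm.
by rewrite uN linear0.
Qed.

Lemma gen_eigenspace0 h : gen_eigenspace T h 0.
Proof. by exists 0%N. Qed.

Lemma gen_eigenspace_comb h c u v :
  gen_eigenspace T h u -> gen_eigenspace T h v -> gen_eigenspace T h (c *: u + v).
Proof.
move=> [N uN] [N' vN']; exists (maxn N N').
rewrite nilpotent_atE iter_shift_linear.
have := nilpotent_at_leq (leq_maxl N N') uN; rewrite nilpotent_atE => ->.
have := nilpotent_at_leq (leq_maxr N N') vN'; rewrite nilpotent_atE => ->.
by rewrite scaler0 addr0.
Qed.

Lemma gen_eigenspace_shift h c u :
  gen_eigenspace T h u -> gen_eigenspace T h (shift c u).
Proof. by move=> [N uN]; exists N; exact: nilpotent_at_shift. Qed.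

(** By induction on the nilpotency order at [h], the vector [u] is a genuine
    eigenvector for [h]; then [(T - c)^N u = (h - c)^N u], which can vanish only
    if [u] does. *)
Lemma gen_eigenspace_disjoint h c u : h != c ->
  gen_eigenspace T h u -> gen_eigenspace T c u -> u = 0.
Proof.
move=> hc [N]; elim: N u => [//|N IHN] u uN uc.
have su0 : shift h u = 0.
  apply: IHN; last exact: gen_eigenspace_shift.
  by move: uN; rewrite !nilpotent_atE iterSr.
have iterE N' : iter N' (shift c) u = (h - c) ^+ N' *: u.
  elim: N' => [|N' /= ->]; first by rewrite expr0 scale1r.
  by rewrite linearZ /= (shiftE h) su0 add0r scalerA -exprSr.
case: uc => N'; rewrite nilpotent_atE iterE => /eqP; rewrite scaler_eq0 => /orP[|/eqP//].
by rewrite expf_eq0 subr_eq0 (negPf hc) andbF.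
Qed.

Section Projections.
Context {I : choiceType} (lambda : I -> K).
Hypothesis direct : is_direct_sum (fun i => gen_eigenspace T (lambda i)).

Lemma direct_sum_eq (f g : I -> U) :
  finite_set [set i | f i != 0] -> finite_set [set i | g i != 0] ->
  (forall i, gen_eigenspace T (lambda i) (f i)) ->
  (forall i, gen_eigenspace T (lambda i) (g i)) ->
  \sum_(i \in [set: I]) f i = \sum_(i \in [set: I]) g i -> f = g.
Proof.
move=> ff gf fT gT fg.
have [k [_ k_uniq]] := direct (\sum_(i \in [set: I]) f i).
by rewrite -(k_uniq f) // -(k_uniq g).
Qed.

Lemma fsum_supported (A : {fset I}) (f : I -> U) : (forall i, f i != 0 -> i \in A) ->
  \sum_(i \in [set: I]) f i = \sum_(i <- A) f i.
Proof. by move=> fA; apply: fsbigTE => i; apply: contraNeq; exact: fA. Qed.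

Lemma finite_support_sub (f g : I -> U) : (forall i, f i = 0 -> g i = 0) ->
  finite_set [set i | f i != 0] -> finite_set [set i | g i != 0].
Proof.
by move=> fg; apply: sub_finite_set => i /=; apply: contra_neq; exact: fg.
Qed.

Lemma fsum_linear (g : {linear U -> U}) (f : I -> U) : finite_set [set i | f i != 0] ->
  g (\sum_(i \in [set: I]) f i) = \sum_(i \in [set: I]) g (f i).
Proof.
move=> ff; set A := fset_set [set i | f i != 0].
rewrite !(@fsum_supported A) ?linear_sum// => i.
  by move=> gf0; rewrite in_fset_set// inE /=; apply: contra_neq gf0 => ->; rewrite linear0.
by move=> f0; rewrite in_fset_set// inE.
Qed.

(** The components of a vector depend linearly on it and commute with [T]
    because the decomposition is unique. The same uniqueness shows that the
    components of a vector of generalized eigenvalue [h] have generalized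
    eigenvalue [h] too, hence vanish wherever [lambda i] differs from [h]. *)
Lemma eigenprojections : exists p : I -> U -> U,
  [/\ forall i, linear (p i),
      forall i u, gen_eigenspace T (lambda i) (p i u),
      forall i u, p i (T u) = T (p i u),
      forall i h u, h != lambda i -> gen_eigenspace T h u -> p i u = 0
    & forall u, exists A : seq I, u = \sum_(i <- A) p i u].
Proof.
have /choice[q qP] : forall u, exists f : I -> U,
    [/\ finite_set [set i | f i != 0], forall i, gen_eigenspace T (lambda i) (f i)
      & u = \sum_(i \in [set: I]) f i].
  by move=> u; have [f [fP _]] := direct u; exists f.
have q_lin c u v : q (c *: u + v) = c *: q u + q v.
  have [uf uT us] := qP u; have [vf vT vs] := qP v.
  have [wf wT ws] := qP (c *: u + v).
  have sf : finite_set [set i | (c *: q u + q v) i != 0].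
    apply: (@sub_finite_set _ _ ([set i | q u i != 0] `|` [set i | q v i != 0]));
      last by rewrite finite_setU.
    move=> i /=; rewrite fct_combE; have [->|] := eqVneq (q u i) 0; last by left.
    by rewrite scaler0 add0r; right.
  apply: direct_sum_eq => //; first by move=> i; exact: gen_eigenspace_comb.
  rewrite -ws {1}us {1}vs.
  pose A := fset_set ([set i | q u i != 0] `|` [set i | q v i != 0]).
  have Af : finite_set ([set i | q u i != 0] `|` [set i | q v i != 0]).
    by rewrite finite_setU.
  rewrite !(@fsum_supported A); first last.
  - by move=> i ui; rewrite in_fset_set// inE /=; left.
  - by move=> i vi; rewrite in_fset_set// inE /=; right.
  - move=> i; rewrite fct_combE in_fset_set// inE /=.
    have [->|] := eqVneq (q u i) 0; last by left.
    by rewrite scaler0 add0r; right.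
  by rewrite scaler_sumr -big_split.
have q_shift h u : q (shift h u) = fun i => shift h (q u i).
  have [uf uT us] := qP u; have [wf wT ws] := qP (shift h u).
  apply: direct_sum_eq => //.
  - by apply: finite_support_sub uf => i ->; rewrite linear0.
  - by move=> i; exact: gen_eigenspace_shift.
  - by rewrite -ws {1}us fsum_linear.
have q_T u : q (T u) = fun i => T (q u i).
  have -> : T u = shift 0 u by rewrite /shift scale0r subr0.
  by rewrite q_shift; apply/funext => i; rewrite /shift scale0r subr0.
exists (fun i u => q u i); split.
- by move=> i c u v; rewrite q_lin.
- by move=> i u; have [] := qP u.
- by move=> i u; rewrite q_T.
- move=> i h u hi [N uN]; have [_ uT _] := qP u.
  apply: (gen_eigenspace_disjoint hi); last exact: uT.
  exists N; rewrite nilpotent_atE.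
  have qN : q (iter N (shift h) u) = fun i => iter N (shift h) (q u i).
    by elim: N {uN} => //= N IHN; rewrite q_shift IHN.
  have := congr1 (@^~ i) qN; rewrite /= => <-.
  move: uN; rewrite nilpotent_atE => ->.
  have := q_lin (-1) 0 0; rewrite scaler0 addr0 scaleN1r addNr => ->.
  by [].
- move=> u; have [uf _ us] := qP u.
  exists (fset_set [set i | q u i != 0]); rewrite {1}us.
  by apply: fsum_supported => i ui; rewrite in_fset_set// inE.
Qed.

End Projections.
End GeneralizedEigenspaces.

(** * Families of bilinear maps with a logarithmic derivation rule *)

(** [G k] is modelled on the coefficient of x^s (log x)^k in an operator F, for
    a fixed exponent [s]: if [T0], [T1], [T2] are the actions of L(0), then
    [G_derivation] says that L(0) acts on the product as a derivation, up to
    the term x F'(x), whose coefficient at x^s (log x)^k is s G_k + (k+1) G_{k+1}. *)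
Section LogDerivation.
Context {K : numFieldType} {U0 U1 U2 : lmodType K}.
Variables (T0 : {linear U0 -> U0}) (T1 : {linear U1 -> U1}).
Variables (T2 : {linear U2 -> U2}) (s : K) (G : nat -> U1 -> U2 -> U0).
Hypothesis G_linearl : forall k m2, linear (G k ^~ m2).
Hypothesis G_linearr : forall k m1, linear (G k m1).
Hypothesis G_derivation : forall k m1 m2,
  T0 (G k m1 m2) = G k (T1 m1) m2 + G k m1 (T2 m2) + s *: G k m1 m2
                   + k.+1%:R *: G k.+1 m1 m2.

Lemma log_family0l k m2 : G k 0 m2 = 0.
Proof. exact: (linear_fun0 (@G_linearl k m2)). Qed.

Lemma log_family0r k m1 : G k m1 0 = 0.
Proof. exact: (linear_fun0 (@G_linearr k m1)). Qed.

Lemma log_shift h1 h2 k m1 m2 : shift T0 (h1 + h2 + s) (G k m1 m2) =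
  G k (shift T1 h1 m1) m2 + G k m1 (shift T2 h2 m2) + k.+1%:R *: G k.+1 m1 m2.
Proof.
rewrite /shift (linear_funB (@G_linearl k m2)) (linear_funZ (@G_linearl k m2)).
rewrite (linear_funB (G_linearr k m1)) (linear_funZ (G_linearr k m1)) G_derivation.
rewrite !scalerDl !opprD [LHS]addrAC; congr (_ + _).
by rewrite addrACA subrr addr0 addrACA.
Qed.

(** The shift of [T0] in [log_shift] trades one step in [k] for one step in one
    of the three nilpotency orders, and these add up to at most
    [N0 + N1 + N2]. So the induction on [k] proves more: the vector obtained
    from [G k m1 m2] by [i] shifts vanishes once [i + k] reaches this sum. *)
Lemma log_degree_bound N0 h1 h2 :
  (forall u, gen_eigenspace T0 (h1 + h2 + s) u ->
     nilpotent_at T0 (h1 + h2 + s) N0 u) ->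
  (forall m1 m2, gen_eigenspace T1 h1 m1 -> gen_eigenspace T2 h2 m2 ->
     gen_eigenspace T0 (h1 + h2 + s) (G 0 m1 m2)) ->
  forall N1 N2 k m1 m2, nilpotent_at T1 h1 N1 m1 -> nilpotent_at T2 h2 N2 m2 ->
    (N0 + N1 + N2 <= k)%N -> G k m1 m2 = 0.
Proof.
move=> nil0 weight0.
suff vanish k : forall i N1 N2 m1 m2, nilpotent_at T1 h1 N1 m1 ->
    nilpotent_at T2 h2 N2 m2 -> (N0 + N1 + N2 <= i + k)%N ->
    iter i (shift T0 (h1 + h2 + s)) (G k m1 m2) = 0.
  by move=> N1 N2 k m1 m2 m1N m2N le_k; exact: (vanish k 0%N N1 N2).
elim: k => [|k IHk] i N1 N2 m1 m2 m1N m2N le_i.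
  apply: (@nilpotent_at_leq _ _ _ _ N0); first by rewrite addn0 in le_i; lia.
  by apply: nil0; apply: weight0; [exists N1|exists N2].
have := IHk i.+1 _ _ _ _ m1N m2N; rewrite addSnnS => /(_ le_i).
rewrite iterSr log_shift !linearD linearZ /=.
have -> : iter i (shift T0 (h1 + h2 + s)) (G k (shift T1 h1 m1) m2) = 0.
  case: N1 m1N le_i => [m10|N1 m1N] le_i.
    move: m10; rewrite nilpotent_atE /= => ->.
    by rewrite linear0 log_family0l linear0.
  by apply: (IHk i N1 N2) => //; [move: m1N; rewrite !nilpotent_atE iterSr|lia].
have -> : iter i (shift T0 (h1 + h2 + s)) (G k m1 (shift T2 h2 m2)) = 0.
  case: N2 m2N le_i => [m20|N2 m2N] le_i.
    move: m20; rewrite nilpotent_atE /= => ->.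
    by rewrite linear0 log_family0r linear0.
  by apply: (IHk i N1 N2) => //; [move: m2N; rewrite !nilpotent_atE iterSr|lia].
by rewrite !add0r => /eqP; rewrite scaler_eq0 pnatr_eq0 => /eqP.
Qed.

(** The maps [p i] are the projections onto the generalized eigenspaces of [T0];
    [G_finite] is the form in which either support condition on logarithmic
    powers is used. *)
Section Weights.
Context {I : choiceType} (lambda : I -> K) (p : I -> U0 -> U0).
Hypothesis p_linear : forall i, linear (p i).
Hypothesis p_weight : forall i u, gen_eigenspace T0 (lambda i) (p i u).
Hypothesis p_comm : forall i u, p i (T0 u) = T0 (p i u).
Hypothesis G_finite : forall i m1 m2,
  exists k0, forall k, (k0 <= k)%N -> p i (G k m1 m2) = 0.

(** By induction on the nilpotency orders of [m1] and [m2], the components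
    [w_k = p i (G k m1 m2)] satisfy [(T0 - c) w_k = (k+1) w_{k+1}] with
    [c = h1 + h2 + s]. They vanish for large [k], and [T0 - c] is injective on
    the eigenspace of [lambda i], which is not [c]: so they vanish for all [k],
    by descending induction. *)
Lemma component_eq0 i h1 h2 N1 N2 k m1 m2 : lambda i != h1 + h2 + s ->
  nilpotent_at T1 h1 N1 m1 -> nilpotent_at T2 h2 N2 m2 -> p i (G k m1 m2) = 0.
Proof.
move=> ic.
have [pD pZ] := (linear_funD (p_linear i), linear_funZ (p_linear i)).
have p_shift c u : p i (shift T0 c u) = shift T0 c (p i u).
  by rewrite /shift -!scaleNr pD pZ p_comm.
have [n] := ubnP (N1 + N2); elim: n N1 N2 k m1 m2 => // n IHn N1 N2 k m1 m2.
move=> ltn m1N m2N.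
have comp_shift j : shift T0 (h1 + h2 + s) (p i (G j m1 m2)) =
    j.+1%:R *: p i (G j.+1 m1 m2).
  rewrite -p_shift log_shift !pD pZ.
  have -> : p i (G j (shift T1 h1 m1) m2) = 0.
    case: N1 m1N ltn => [m10|N1 m1N] ltn.
      move: m10; rewrite nilpotent_atE /= => ->.
      by rewrite linear0 log_family0l (linear_fun0 (p_linear i)).
    by apply: (IHn N1 N2) => //; move: m1N; rewrite !nilpotent_atE iterSr.
  have -> : p i (G j m1 (shift T2 h2 m2)) = 0.
    case: N2 m2N ltn => [m20|N2 m2N] ltn.
      move: m20; rewrite nilpotent_atE /= => ->.
      by rewrite linear0 log_family0r (linear_fun0 (p_linear i)).
    by apply: (IHn N1 N2) => //; [lia|move: m2N; rewrite !nilpotent_atE iterSr].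
  by rewrite !add0r.
have [k0 k0P] := G_finite i m1 m2.
have [d] := ubnP (k0 - k); elim: d k => // d IHd k ltd.
have [/k0P//|lek] := leqP k0 k.
have wk1 : p i (G k.+1 m1 m2) = 0 by apply: IHd; lia.
apply: (gen_eigenspace_disjoint ic (p_weight i _)).
by exists 1%N; rewrite nilpotent_atE /= comp_shift wk1 scaler0.
Qed.

End Weights.
End LogDerivation.

(** * Binomial sums and sums of series *)

Section VertexOperatorAlgebra.
Context {R : realType} {V : voa R}.
Local Notation C := R[i].

HB.instance Definition _ (M : vmod V) (a : V) (n : int) :=
  GRing.isLinear.Build C M M _ (@act R V M a n) (@act_linear R V M a n).

HB.instance Definition _ (M : vmod V) (n : int) :=
  GRing.isLinear.Build C M M _ (@Lmode R V M n) (@Lmode_linear R V M n).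

Lemma binz0 (n : int) : binz n 0 = 1 :> C.
Proof. by rewrite /binz big_ord0 fact0 divr1. Qed.

Lemma binzn1 (n : int) : binz n 1 = n%:~R :> C.
Proof. by rewrite /binz big_ord1 subr0 divr1. Qed.

Lemma binz_small (n k : nat) : (n < k)%N -> binz n%:Z k = 0 :> C.
Proof.
by move=> nk; rewrite /binz (bigD1 (Ordinal nk))//= subrr mulr0z !mul0r.
Qed.

Section SeriesSums.
Context {M : lmodType C}.
Implicit Types (f g : nat -> series M) (S : series M).

Lemma series_sum_unique f S S' : series_sum f S -> series_sum f S' -> S = S'.
Proof.
move=> fS fS'; apply/funext => s; apply/funext => k.
exact: (sum_is_unique (fS s k) (fS' s k)).
Qed.

Lemma series_sum_exists f :
  (forall s k, exists N, forall i, (N <= i)%N -> f i s k = 0) ->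
  exists S, series_sum f S.
Proof.
move=> f0; have /choice[S SP] (sk : C * nat) :
    exists v, sum_is (fun i => f i sk.1 sk.2) v.
  by have [N fN] := f0 sk.1 sk.2; eexists; exact: sum_is_truncated fN.
by exists (fun s k => S (s, k)) => s k; exact: (SP (s, k)).
Qed.

Lemma series_sumB f g S S' : series_sum f S -> series_sum g S' ->
  series_sum (fun k => f k - g k) (S - S').
Proof.
move=> fS gS'; have := series_sum_comb (-1) gS' fS.
rewrite scaleN1r addrC; congr (series_sum _ _).
by apply/funext => k; rewrite scaleN1r addrC.
Qed.

(** The commutator formula for [a(0)] has a single term; for [a] the conformal
    vector this is what relates the two forms of the L(-1)-derivative axiom. *)
Lemma commutator_sum0 f S :
  series_sum (fun k : nat => binz 0 k *: xmul (0 - k%:Z) (f k)) S -> S = f 0%N.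
Proof.
move=> fS; apply: (series_sum_unique fS) => s k.
have -> : f 0%N s k = \sum_(i < 1) (binz 0 i *: xmul (0 - i%:Z) (f i)) s k.
  rewrite big_ord1 /= binz0 scale1r.
  by rewrite /xmul subrr subr0.
apply: (@sum_is_truncated _ M _ 1) => i i1.
by rewrite (binz_small i1) scale0r.
Qed.

(** The exponents of [f] that are congruent to [s] modulo the integers are
    bounded below: among the finitely many [t], only those congruent to [s]
    matter, and each of these bounds the exponents in [t + N] from below. *)
Lemma log_laurent_truncated (f : series M) s k : log_laurent f ->
  exists N, forall n, (N <= n)%N -> f (s - n%:R) k = 0.
Proof.
move=> [K [r fr]].
suff [N NP] : exists N, forall n t j, (N <= n)%N -> t \in r -> s - n%:R <> t + j%:R.
  exists N => n Nn; apply/eqP; apply: contraT => /fr[_ [t tr [j sj]]].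
  by case: (NP n t j Nn tr).
elim: r {K fr} => [|t r [N NP]]; first by exists 0%N.
have [[d sd]|no_d] := pselect (exists d : nat, s = t + d%:R); last first.
  exists N => n t' j Nn; rewrite inE => /predU1P[->|]; last exact: NP.
  move=> snj; apply: no_d; exists (j + n)%N.
  by rewrite natrD addrA -snj subrK.
exists (maxn N d.+1) => n t' j; rewrite geq_max => /andP[Nn dn].
rewrite inE => /predU1P[->|]; last exact: NP.
rewrite sd => /eqP; rewrite subr_eq -addrA -natrD (inj_eq (addrI t)) eqr_nat => /eqP.
lia.
Qed.

End SeriesSums.

(** * Weights and logarithmic degrees of operators *)

Lemma weight_projections (M : vmod V) :
  exists (n : nat) (Delta : 'I_n -> C) (p : 'I_n * nat -> M -> M),
  [/\ forall i, linear (p i),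
      forall i u, weight_space (Delta i.1 + i.2%:R) (p i u),
      forall i u, p i (Lmode 0 u) = Lmode 0 (p i u),
      forall i h u, h != Delta i.1 + i.2%:R -> weight_space h u -> p i u = 0
    & forall u, exists A : seq ('I_n * nat), u = \sum_(i <- A) p i u].
Proof.
have [n [Delta dir]] := vmod_grading M.
by have [p pP] := eigenprojections (T := @Lmode R V M 0) dir; exists n, Delta, p.
Qed.

Lemma weight_space_comb (M : vmod V) h (c : C) (u v : M) :
  weight_space h u -> weight_space h v -> weight_space h (c *: u + v).
Proof. exact: (gen_eigenspace_comb (T := @Lmode R V M 0)). Qed.

Lemma weight_ind (M : vmod V) (Q : M -> Prop) :
  Q 0 -> (forall u v, Q u -> Q v -> Q (u + v)) ->
  (forall h u, weight_space h u -> Q u) -> forall u, Q u.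
Proof.
move=> Q0 QD Qw u.
have [n [Delta [p [_ pw _ _ /(_ u)[A ->]]]]] := weight_projections M.
by apply: big_ind => // i _; exact: Qw (pw i u).
Qed.

(** The hypotheses on [F] are common consequences of the axioms of both kinds of
    operators; [F_bounded] is weaker than either support condition. *)
Section LogOperators.
Context {M0 M1 M2 : vmod V} (F : PI12_data M0 M1 M2).
Hypothesis F_linearl : forall m2, linear (F^~ m2).
Hypothesis F_linearr : forall m1, linear (F m1).
Hypothesis F_deriv : forall m1 m2, F (Lmode (-1) m1) m2 = Defs.deriv (F m1 m2).
Hypothesis F_commutator : forall a (n : int) m1 m2, exists S : series M0,
  series_sum (fun k : nat => binz n k *:
    xmul (n - k%:Z) (F (act a k%:Z m1) m2)) S /\
  F m1 (act a n m2) = smap (act a n) (F m1 m2) - S.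
Hypothesis F_bounded : forall u : M0 -> C^o, restricted_dual u ->
  forall m1 m2, exists k0, forall s k, (k0 <= k)%N -> u (F m1 m2 s k) = 0.

(** The commutator formula for omega(1) = L(0) has the two terms
    x F(L(-1) m1, m2) and F(L(0) m1, m2), and the first is x F'(m1, m2). *)
Lemma L0_derivation s k m1 m2 : Lmode 0 (F m1 m2 s k) =
  F (Lmode 0 m1) m2 s k + F m1 (Lmode 0 m2) s k + s *: F m1 m2 s k
  + k.+1%:R *: F m1 m2 s k.+1.
Proof.
have [S [/(_ s k) S_sum]] := F_commutator (omega V) 1 m1 m2.
move=> /(congr1 (fun f : series M0 => f s k)) FS.
have {}FS : F m1 (Lmode 0 m2) s k = Lmode 0 (F m1 m2 s k) - S s k.
  by move: FS; rewrite /Lmode /Lop add0r.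
have {S_sum} S_eq : S s k = s *: F m1 m2 s k + k.+1%:R *: F m1 m2 s k.+1
    + F (Lmode 0 m1) m2 s k.
  apply: (sum_is_unique S_sum).
  have -> : s *: F m1 m2 s k + k.+1%:R *: F m1 m2 s k.+1
      + F (Lmode 0 m1) m2 s k =
      \sum_(i < 2) (binz 1 i *:
        xmul (1 - i%:Z) (F (act (omega V) i%:Z m1) m2)) s k.
    rewrite 2!big_ord_recl big_ord0 addr0 binz0 binzn1 !scale1r.
    congr (_ + _); last by rewrite addr0 /xmul /Lmode /Lop add0r subrr subr0.
    have := F_deriv m1 m2; rewrite /Lmode /Lop addNr => ->.
    rewrite /xmul /Defs.deriv. by rewrite subrK.
  apply: (@sum_is_truncated _ M0 _ 2) => i i2.
  by rewrite (binz_small i2) scale0r.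
rewrite -[LHS](subrK (S s k)) -FS S_eq [LHS]addrC -[LHS]addrA [LHS]addrC.
by rewrite [LHS]addrA.
Qed.

(** [component_eq0] applies because a form on a weight space, composed with the
    projection onto it, lies in the restricted dual; as the weight space is
    finite-dimensional, finitely many such forms detect when a component
    vanishes. *)
Lemma weight_coefficient h1 h2 m1 m2 s k :
  weight_space h1 m1 -> weight_space h2 m2 ->
  weight_space (h1 + h2 + s) (F m1 m2 s k).
Proof.
have [n [Delta [p [p_lin p_weight p_comm p_kill p_sum]]]] := weight_projections M0.
move=> [N1 m1N] [N2 m2N].
have p_finite i m1' m2' :
    exists k0, forall k, (k0 <= k)%N -> p i (F m1' m2' s k) = 0.
  have [e eP] := vmod_finite M0 (Delta i.1 + i.2%:R).
  have [d [u [u_lin u_inj]]] := span_coordinates e.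
  have up_dual j : restricted_dual (u j \o p i : M0 -> C^o).
    split=> [c x y /=|]; first by rewrite p_lin u_lin//; exact/eP/p_weight.
    apply: (@sub_finite_set _ _ [set Delta i.1 + i.2%:R]); last exact: finite_set1.
    move=> h [m mw] /=; apply: contra_neqP => /eqP hi; rewrite (p_kill i h)//.
    have := u_lin j (-1) (p i m) (p i m).
    rewrite scaleN1r addNr mulN1r addNr; apply; apply/eP/p_weight.
  have /choice[kk kkP] j := F_bounded (up_dual j) m1' m2'.
  exists (\max_(j < d) kk j) => k' lek; apply: u_inj; first exact/eP/p_weight.
  move=> j jd; apply: kkP; apply: leq_trans lek.
  exact: (leq_bigmax (Ordinal jd)).
have [A ->] := p_sum (F m1 m2 s k).
apply: (big_ind (weight_space (h1 + h2 + s))).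
- exact: gen_eigenspace0.
- by move=> u v; rewrite -{2}[u]scale1r; exact: weight_space_comb.
- move=> i _; have [<-|ic] := eqVneq (Delta i.1 + i.2%:R) (h1 + h2 + s).
    exact: p_weight.
  have -> : p i (F m1 m2 s k) = 0; last exact: gen_eigenspace0.
  apply: (@component_eq0 C M0 M1 M2 (@Lmode R V M0 0) (@Lmode R V M1 0)
    (@Lmode R V M2 0) s (fun k m1 m2 => F m1 m2 s k) _ _ _ _
    (fun i => Delta i.1 + i.2%:R) p _ _ _ _ i h1 h2 N1 N2 k) => //.
  + by move=> k' m2' c x y; rewrite F_linearl.
  + by move=> k' m1' c x y; rewrite F_linearr.
  + by move=> k' m1' m2'; exact: L0_derivation.
Qed.

(** The nilpotency orders are uniform in the weight, so that one bound serves
    for all homogeneous vectors, and hence for their sums. *)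
Lemma log_bound : exists B, forall m1 m2 s k, (B <= k)%N -> F m1 m2 s k = 0.
Proof.
have [N0 N0P] := vmod_nilpotent M0.
have [N1 N1P] := vmod_nilpotent M1.
have [N2 N2P] := vmod_nilpotent M2.
exists (N0 + N1 + N2)%N => m1 m2 s k lek.
elim/weight_ind: m1 => [|u v u0 v0|h1 m1 m1h].
- by rewrite (linear_fun0 (F_linearl m2)).
- rewrite (linear_funD (F_linearl m2)) -[LHS]/(F u m2 s k + F v m2 s k).
  by rewrite u0 v0 addr0.
elim/weight_ind: m2 => [|u v u0 v0|h2 m2 m2h].
- by rewrite (linear_fun0 (F_linearr m1)).
- rewrite (linear_funD (F_linearr m1)) -[LHS]/(F m1 u s k + F m1 v s k).
  by rewrite u0 v0 addr0.
apply: (@log_degree_bound C M0 M1 M2 (@Lmode R V M0 0) (@Lmode R V M1 0)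
    (@Lmode R V M2 0) s (fun k m1 m2 => F m1 m2 s k) _ _ _ N0 h1 h2 _ _ N1 N2) => //.
+ by move=> k' m2' c x y; rewrite F_linearl.
+ by move=> k' m1' c x y; rewrite F_linearr.
+ by move=> k' m1' m2'; exact: L0_derivation.
+ by move=> u; exact: N0P.
+ by move=> m1' m2'; exact: weight_coefficient.
+ exact: N1P.
+ exact: N2P.
Qed.

(** For homogeneous vectors, the exponents are weights of [M0] shifted by
    [h1 + h2], and the weights of [M0] lie in finitely many [Delta i + N]. *)
Lemma log_laurent_operator m1 m2 : log_laurent (F m1 m2).
Proof.
have log_laurent0 : log_laurent (0 : series M0).
  by exists 0%N, [::] => s k; rewrite eqxx.
have log_laurentD (f g : series M0) :
    log_laurent f -> log_laurent g -> log_laurent (f + g).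
  by rewrite -{2}[f]scale1r; exact: log_laurent_comb.
elim/weight_ind: m1 => [|u v u0 v0|h1 m1 m1h].
- by rewrite (linear_fun0 (F_linearl m2)).
- by rewrite (linear_funD (F_linearl m2)); exact: log_laurentD.
elim/weight_ind: m2 => [|u v u0 v0|h2 m2 m2h].
- by rewrite (linear_fun0 (F_linearr m1)).
- by rewrite (linear_funD (F_linearr m1)); exact: log_laurentD.
have [n [Delta [p [p_lin p_weight p_comm p_kill p_sum]]]] := weight_projections M0.
have [B BP] := log_bound.
exists B, [seq Delta i - (h1 + h2) | i <- enum 'I_n] => s k Fsk; split.
  by rewrite ltnNge; apply: contra_neqN Fsk; exact: BP.
have [i hi] : exists i : 'I_n * nat, h1 + h2 + s = Delta i.1 + i.2%:R.
  have [A FA] := p_sum (F m1 m2 s k).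
  apply: contrapT => /forallNP noi; move/eqP: Fsk; apply.
  rewrite FA big1// => i _; apply: (p_kill i (h1 + h2 + s)).
    exact/eqP/noi.
  exact: weight_coefficient.
exists (Delta i.1 - (h1 + h2)); first by apply: map_f; rewrite mem_enum.
by exists i.2; rewrite addrAC -hi addrC addKr.
Qed.

(** For homogeneous vectors, only the exponents [s] for which [u] is nonzero on
    the weight space of [h1 + h2 + s] contribute. *)
Lemma log_finite_operator (u : M0 -> C^o) m1 m2 :
  restricted_dual u -> log_finite (smap u (F m1 m2)).
Proof.
move=> [u_lin u_fin].
have log_finiteD (f g : series C^o) :
    log_finite f -> log_finite g -> log_finite (f + g).
  by rewrite -{2}[f]scale1r; exact: log_finite_comb.
elim/weight_ind: m1 => [|x y x0 y0|h1 m1 m1h].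
- by rewrite (linear_fun0 (F_linearl m2)) smap0//; exact: log_finite0.
- by rewrite (linear_funD (F_linearl m2)) smapD//; exact: log_finiteD.
elim/weight_ind: m2 => [|x y x0 y0|h2 m2 m2h].
- by rewrite (linear_fun0 (F_linearr m1)) smap0//; exact: log_finite0.
- by rewrite (linear_funD (F_linearr m1)) smapD//; exact: log_finiteD.
have [B BP] := log_bound.
apply: (@sub_finite_set _ _ ([set h - (h1 + h2) | h in
    [set h | exists2 m, weight_space h m & u m != 0]] `*` `I_B)).
  move=> [s k] /= uF; split=> /=.
    exists (h1 + h2 + s); last by rewrite addrAC subrr add0r.
    by exists (F m1 m2 s k) => //; exact: weight_coefficient.
  rewrite ltnNge; apply: contra_neqN uF => /BP; rewrite /smap => ->.
  exact: linear_fun0.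
by apply: finite_setX; [exact: finite_image | exact: finite_II].
Qed.

End LogOperators.
End VertexOperatorAlgebra.

(** * The isomorphism *)

Section Isomorphism.
Context {R : realType} {V : voa R}.
Local Notation C := R[i].

Section Exchange.
Context {M0 M1 M2 : vmod V}.

Definition log_of_PI12 (F : PI12_data M0 M1 M2) : log_data M0 M1 M2 :=
  fun m1 s k m2 => F m1 m2 s k.

Definition PI12_of_log (Y : log_data M0 M1 M2) : PI12_data M0 M1 M2 := series_at Y.

(** The bound on the powers of log x has to be independent of the second
    argument, which (PI0) does not give directly; it comes from [log_bound]. *)
Lemma log_of_PI12P F : is_PI12 F -> is_log_intertwiner (log_of_PI12 F).
Proof.
move=> [F_linl F_linr F_fin F_deriv F_iter F_comm].
have F_bounded (u : M0 -> C^o) : restricted_dual u -> forall m1 m2,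
    exists k0, forall s k, (k0 <= k)%N -> u (F m1 m2 s k) = 0.
  move=> ur m1 m2; have /finite_fsetP[A FA] := F_fin u ur m1 m2.
  exists (\max_(sk <- A) sk.2).+1 => s k; rewrite ltnNge; apply: contraNeq => uF.
  apply: (@leq_bigmax_seq _ _ xpredT (fun sk : C * nat => sk.2) (s, k)) => //.
  by have : [set` A] (s, k) by rewrite -FA.
have [B FB] := log_bound F_linl F_linr F_deriv F_comm F_bounded.
have atE m1 m2 : series_at (log_of_PI12 F) m1 m2 = F m1 m2 by [].
split.
- move=> c x y; apply/funext => s; apply/funext => k; apply/funext => m2.
  by rewrite /log_of_PI12 (F_linl m2).
- by move=> m1 s k c x y; rewrite /log_of_PI12 (F_linr m1).
- by move=> m1; exists B => s k Bk; apply/funext => m2; exact: FB.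
- exact: log_laurent_operator F_linl F_linr F_deriv F_comm F_bounded.
- move=> m1 m2; rewrite !atE -F_deriv.
  have [S [/commutator_sum0 -> FS]] := F_comm (omega V) 0 m1 m2.
  move: FS; rewrite /Lmode /Lop addNr => ->.
  by rewrite opprB addrC subrK.
- move=> a n m1 m2.
  have [S [S_sum FS]] := F_comm a n m1 m2.
  have -> : smap (act a n) (series_at (log_of_PI12 F) m1 m2) -
      series_at (log_of_PI12 F) m1 (act a n m2) = S; last exact: S_sum.
  by rewrite !atE FS opprB addrC subrK.
- move=> a n m1 m2.
  have [S1 [S2 [S1_sum S2_sum FS]]] := F_iter a n m1 m2.
  rewrite !atE FS; have := series_sumB S1_sum S2_sum; congr (series_sum _ _).
  by apply/funext => k; rewrite scalerBr.
Qed.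

(** The sum in the iterate formula splits because each half converges
    separately: the first since [F m1 m2] has exponents bounded below in each
    class modulo the integers, the second since [a(k) m2 = 0] for large [k]. *)
Lemma PI12_of_logP Y : is_log_intertwiner Y -> is_PI12 (PI12_of_log Y).
Proof.
move=> [Y_lin Y_linc Y_log Y_laurent Y_deriv Y_comm Y_iter].
pose F := PI12_of_log Y.
have F_linl m2 : linear (F^~ m2).
  by move=> c x y; rewrite /F /PI12_of_log /series_at Y_lin.
have F_linr m1 : linear (F m1).
  move=> c x y; apply/funext => s; apply/funext => k.
  by rewrite /F /PI12_of_log /series_at /smap (Y_linc m1 s k).
have F_comm a (n : int) m1 m2 : exists S : series M0,
    series_sum (fun k : nat => binz n k *:
      xmul (n - k%:Z) (F (act a k%:Z m1) m2)) S /\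
    F m1 (act a n m2) = smap (act a n) (F m1 m2) - S.
  by eexists; split; [exact: Y_comm | rewrite opprB addrC subrK].
have F_deriv m1 m2 : F (Lmode (-1) m1) m2 = Defs.deriv (F m1 m2).
  rewrite -[RHS]Y_deriv.
  have [S [/commutator_sum0 -> FS]] := F_comm (omega V) 0 m1 m2.
  have -> : series_at Y m1 (Lmode (-1) m2) = F m1 (Lmode (-1) m2) by [].
  move: FS; rewrite /Lmode /Lop addNr => ->.
  by rewrite opprB addrC subrK.
have F_bounded (u : M0 -> C^o) : restricted_dual u -> forall m1 m2,
    exists k0, forall s k, (k0 <= k)%N -> u (F m1 m2 s k) = 0.
  move=> [u_lin _] m1 m2; have [k0 Yk0] := Y_log m1; exists k0 => s k lek.
  by rewrite /F /PI12_of_log /series_at /smap Yk0// (linear_fun0 u_lin).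
split=> //.
- move=> u ur m1 m2.
  exact: (log_finite_operator F_linl F_linr F_deriv F_comm F_bounded).
- move=> a n m1 m2.
  have [S1 S1_sum] : exists S, series_sum (fun k : nat => binz n k *:
      nxmul k%:Z (smap (act a (n - k%:Z)) (F m1 m2))) S.
    apply: series_sum_exists => s k.
    have [N FN] := log_laurent_truncated s k (Y_laurent m1 m2).
    exists N => i Ni.
    have -> : (binz n i *: nxmul i (smap (act a (n - i%:Z)) (F m1 m2))) s k =
        binz n i *: (sgn i *: act a (n - i%:Z) (F m1 m2 (s - i%:R) k)) by [].
    by rewrite [F m1 m2 _ _]FN// (linear_fun0 (@act_linear _ _ _ _ _)) !scaler0.
  have [S2 S2_sum] : exists S, series_sum (fun k : nat => binz n k *:
      nxmul (n - k%:Z) (F m1 (act a k%:Z m2))) S.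
    apply: series_sum_exists => s k.
    have [N aN] := act_truncation (vmod_laws M2) a m2.
    exists N => i Ni; rewrite aN//.
    by rewrite (linear_fun0 (F_linr m1)) nxmul0 scaler0.
  exists S1, S2; split => //.
  apply: (series_sum_unique (Y_iter a n m1 m2)).
  have := series_sumB S1_sum S2_sum; congr (series_sum _ _).
  by apply/funext => k; rewrite scalerBr.
Qed.

End Exchange.

Section Bundled.
Context {M0 M1 M2 : vmod V}.

Definition exchange (F : PI12_obj M0 M1 M2) : Ilog_obj M0 M1 M2 :=
  mk_elt (S := Ilog_space M0 M1 M2)
    (log_of_PI12P (elt_in (S := PI12_space M0 M1 M2) F)).

Definition exchange_inv (Y : Ilog_obj M0 M1 M2) : PI12_obj M0 M1 M2 :=
  mk_elt (S := PI12_space M0 M1 M2)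
    (PI12_of_logP (elt_in (S := Ilog_space M0 M1 M2) Y)).

Lemma exchange_linear : linear exchange.
Proof.
move=> c F G; apply: (@elt_inj _ _ (Ilog_space M0 M1 M2)).
by rewrite elt_linear /exchange !elt_mk elt_linear.
Qed.

HB.instance Definition _ := GRing.isLinear.Build C _ _ _ exchange exchange_linear.

Lemma exchange_bij : bijective exchange.
Proof.
exists exchange_inv => x.
  by apply: (@elt_inj _ _ (PI12_space M0 M1 M2)).
by apply: (@elt_inj _ _ (Ilog_space M0 M1 M2)).
Qed.

End Bundled.
End Isomorphism.

Theorem proposition5p7 (R : realType) (V : voa R) :
  naturally_isomorphic (PI12 V) (Ilog V).
Proof.
exists (fun M0 M1 M2 => @exchange R V M0 M1 M2 : {linear _ -> _}).
split=> [M0 M1 M2|M0 M1 M2 N0 N1 N2 f g1 g2 x]; first exact: exchange_bij.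
by apply: (@elt_inj _ _ (Ilog_space N0 N1 N2)).
Qed.
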